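(* Let $\mathscr D$ be a dyadic system in $\mathbb R^d$ without quadrants. Let $E$ and $H$ be Banach spaces, and suppose that $t$ is a bilinear form (with values in $\mathbb R$) defined on $F\times G:=L^\infty_c(\mathbb R^d;E)\times L^\infty_c(\mathbb R^d;H)$ and bounded with respect to the norm of $L^p(\mathbb R^d;E)\times L^q(\mathbb R^d;H)$ for some exponents $p,q\in[1,\infty]$ with $1/p+1/q\ge1$. Let $\varepsilon>0$ and $c\ge 0$ be constants, and suppose that for each $Q\in\mathscr D$ there are norms $\|\cdot\|_{X(Q)}$ on $L^\infty_c(\mathbb R^d;E)$ and $\|\cdot\|_{Y(Q)}$ on $L^\infty_c(\mathbb R^d;H)$ such that the following holds: for all $(f,g)\in F\times G$ and all $Q\in\mathscr D$, there are disjoint $\hat Q_k\in\mathscr D$, $\hat Q_k\subset Q$, with $\sum_k|\hat Q_k|\le\varepsilon|Q|$ and such that, whenever $Q_j\in\mathscr D$, $Q_j\subset Q$, are disjoint, not strictly contained in any $\hat Q_k$, and cover all $\hat Q_k$, then $$\Big|t(1_{3Q}f,1_Qg)-\sum_jt(1_{3Q_j}f,1_{Q_j}g)\Big|\le c\,\|f\|_{X(Q)}\|g\|_{Y(Q)}|Q|.$$ Let $n\in\mathbb Z_+$ be such that $\varepsilon_n:=n\varepsilon<1$, and let $c_n:=c\,n^{3/2}$. Then for all $(\vec f,\vec g)\in F^n\times G^n$, there is a $(1-\varepsilon_n)$-sparse collection $\mathscr S\subset\mathscr D$ such that $$|t(\vec f,\vec g)|\le c_n\sum_{S\in\mathscr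 S}\langle\!\langle\vec f\rangle\!\rangle_{X(S)}\cdot\langle\!\langle\vec g\rangle\!\rangle_{Y(S)}|S|.$$
   Context: Banach and normed spaces are real. $L^\infty_c(\mathbb R^d;E)$ is the space of bounded, compactly supported (strongly measurable) functions $\mathbb R^d\to E$. $3Q$ is the cube concentric with $Q$ and with three times its side length. A dyadic system $\mathscr D=\bigcup_{k\in\mathbb Z}\mathscr D_k$ consists of partitions $\mathscr D_k$ of $\mathbb R^d$ into cubes of side length $2^{-k}$, with $\mathscr D_{k+1}$ refining $\mathscr D_k$; it is without quadrants if any two cubes of $\mathscr D$ are contained in a common cube of $\mathscr D$. A collection $\mathscr S\subset\mathscr D$ is $\delta$-sparse ($0<\delta\le 1$) if there are pairwise disjoint measurable sets $E(S)\subset S$, $S\in\mathscr S$, with $|E(S)|\ge\delta|S|$. For a normed space $X$ with dual $X^*$ and closed dual unit ball $\bar B_{X^*}$, and $\vec x=(x_i)_{i=1}^n\in X^n$, define $\langle\!\langle\vec x\rangle\!\rangle_X:=\{(\langle x_i,x^*\rangle)_{i=1}^n:x^*\in\bar B_{X^*}\}\subset\mathbb R^n$, a convex, compact, origin-symmetric set. For $A,B\subset\mathbb R^n$, $A\cdot B:=\{\vec a\cdot\vec b:\vec a\in A,\vec b\in B\}$; for convex compact symmetric $A,B$ this is an interval $[-r,r]$, which is identified with the number $r\ge 0$. Here $X(Q)$ denotes $L^\infty_c(\mathbb R^d;E)$ equipped with $\|\cdot\|_{X(Q)}$, and similarly $Y(Q)$ denotes $L^\infty_c(\mathbb R^d;H)$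 equipped with $\|\cdot\|_{Y(Q)}$. A bilinear form $t:F\times G\to\mathbb R$ is extended to $\vec f=(f_i)_{i=1}^n\in F^n$, $\vec g=(g_i)_{i=1}^n\in G^n$ by $t(\vec f,\vec g):=\sum_{i=1}^nt(f_i,g_i)$ (equivalently $\sum_it(\vec f\cdot\vec e_i,\vec g\cdot\vec e_i)$ for any orthonormal basis $(\vec e_i)$ of $\mathbb R^n$, where $\vec f\cdot \vec e=\sum_j e_jf_j$). *)

(* Defs.v *)
(* The real numbers are an arbitrary R : realType, and R^d is 'rV[R]_d. *)
From HB Require Import structures.
From mathcomp Require Import all_boot all_order all_algebra.
From mathcomp Require Import all_classical all_reals all_analysis.
Set Implicit Arguments.
Unset Strict Implicit.
Unset Printing Implicit Defensive.
Import Order.TTheory GRing.Theory Num.Theory.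
Import numFieldNormedType.Exports.
Local Open Scope classical_set_scope.
Local Open Scope ring_scope.

(* The sigma-algebra on R^d is generated by the coordinate maps, i.e. it is the
   Borel sigma-algebra. *)
Definition rV_display : measure_display. Proof. exact. Qed.

Section measurable_rV.
Context {R : realType} {d : nat}.

Let coord : 'I_d -> 'rV[R]_d -> measurableTypeR R := fun i x => x ord0 i.

Let rV_set0 : g_sigma_preimage coord set0.
Proof. exact: sigma_algebra0. Qed.

Let rV_setC A : g_sigma_preimage coord A -> g_sigma_preimage coord (~` A).
Proof. exact: sigma_algebraC. Qed.

Let rV_bigcup (F : _^nat) : (forall i, g_sigma_preimage coord (F i)) ->
  g_sigma_preimage coord (\bigcup_i (F i)).
Proof. exact: sigma_algebra_bigcup. Qed.

HB.instance Definition _ := @isMeasurable.Build rV_display 'rV[R]_d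
  (g_sigma_preimage coord) rV_set0 rV_setC rV_bigcup.

Lemma measurable_coord (i : 'I_d) :
  measurable_fun setT (fun x : 'rV[R]_d => x ord0 i : measurableTypeR R).
Proof.
move=> _ Y mY; rewrite setTI; apply: sub_sigma_algebra => /=.
rewrite -bigcup_seq/=; exists i => /=; first by rewrite mem_index_enum.
by exists Y => //; rewrite setTI.
Qed.

Lemma measurable_fun_coordP d1 (T1 : measurableType d1) (f : T1 -> 'rV[R]_d) :
  (forall i, measurable_fun setT (fun x => f x ord0 i : measurableTypeR R)) ->
  measurable_fun setT f.
Proof.
move=> mf _ A mA; rewrite setTI.
have: preimage_set_system setT f (g_sigma_preimage coord) (f @^-1` A).
  by exists A => //; rewrite setTI.
rewrite -g_sigma_preimage_comp; move: (f @^-1` A).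
apply: smallest_sub; first exact: sigma_algebra_measurable.
rewrite -bigcup_seq; apply: bigcup_sub => i _.
by move=> B [C mC <-]; exact: mf.
Qed.

End measurable_rV.

Section lebesgue_rV.
Context {R : realType}.

Definition rV_cons {d} (z : measurableTypeR R * 'rV[R]_d) : 'rV[R]_d.+1 :=
  \row_i oapp (z.2 ord0) z.1 (unlift ord0 i).

Definition rV_uncons {d} (x : 'rV[R]_d.+1) : measurableTypeR R * 'rV[R]_d :=
  (x ord0 ord0, \row_i x ord0 (lift ord0 i)).

Lemma rV_consK d : cancel (@rV_cons d) rV_uncons.
Proof.
move=> [a v]; rewrite /rV_uncons /rV_cons !mxE unlift_none; congr pair.
by apply/rowP => i; rewrite !mxE liftK.
Qed.

Lemma measurable_rV_cons d : measurable_fun setT (@rV_cons d).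
Proof.
apply: measurable_fun_coordP => i.
case: (unliftP ord0 i) => [j ->|->].
  under eq_fun do rewrite mxE liftK/=.
  exact: (measurableT_comp (measurable_coord j) measurable_snd).
by under eq_fun do rewrite mxE unlift_none/=; exact: measurable_fst.
Qed.

Lemma measurable_rV_uncons d : measurable_fun setT (@rV_uncons d).
Proof.
apply: measurable_fun_pair; first exact: measurable_coord.
apply: measurable_fun_coordP => i.
by under eq_fun do rewrite mxE; exact: measurable_coord.
Qed.

Section step.
Context {d : nat} (mu : {sigma_finite_measure set 'rV[R]_d -> \bar R}).

Definition lebesgue_succ : set 'rV[R]_d.+1 -> \bar R :=
  pushforward (lebesgue_measure \x mu)%E (@rV_cons d).

HB.instance Definition _ := Measure.copy lebesgue_succ
  (measure_function_pushforward__canonical__measure_function_Measure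
     (lebesgue_measure \x mu)%E (@measurable_rV_cons d)).

Let lebesgue_succ_sigma_finite : sigma_finite setT lebesgue_succ.
Proof.
have /sigma_finiteP[F [TF ndF Foo]] := sigma_finiteT (@lebesgue_measure R).
have /sigma_finiteP[G [TG ndG Goo]] := sigma_finiteT mu.
exists (fun n => @rV_uncons d @^-1` (F n `*` G n)).
  rewrite -preimage_bigcup (_ : \bigcup_n _ = setT) ?preimage_setT//.
  rewrite -setXTT TF TG predeqE => -[x y]; split.
    by move=> [n _ []/= ? ?]; split; exists n.
  move=> [/= [n _ Fnx] [k _ Gky]]; exists (maxn n k) => //; split.
  - by move: x Fnx; exact/subsetPset/ndF/leq_maxl.
  - by move: y Gky; exact/subsetPset/ndG/leq_maxr.
move=> k; have [? ?] := Foo k; have [? ?] := Goo k; split.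
  rewrite -[X in measurable X]setTI; apply: measurable_rV_uncons => //.
  exact: measurableX.
rewrite /lebesgue_succ /pushforward -comp_preimage.
rewrite (_ : _ \o _ = id); last by apply/funext => z; exact: rV_consK.
by rewrite preimage_id product_measure1E// lte_mul_pinfty// ge0_fin_numE.
Qed.

HB.instance Definition _ := Measure_isSigmaFinite.Build _ _ _ lebesgue_succ
  lebesgue_succ_sigma_finite.

End step.

(* Lebesgue measure on R^d as an iterated product of the one-dimensional one;
   see lebesgue_rV_box for the volume of a box. *)
Fixpoint lebesgue_rV (d : nat) : {sigma_finite_measure set 'rV[R]_d -> \bar R} :=
  match d with
  | 0 => \d_(0 : 'rV[R]_0)
  | d'.+1 => lebesgue_succ (lebesgue_rV d')
  end.

End lebesgue_rV.

Section cubes.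
Context {R : realType} {d : nat}.

(* A pair (center, side length). *)
Definition cube : Type := ('rV[R]_d * R)%type.
HB.instance Definition _ := Choice.on cube.

Definition center (Q : cube) : 'rV[R]_d := Q.1.
Definition side (Q : cube) : R := Q.2.

(* Half-open, so that cubes of a fixed side length can partition R^d. *)
Definition cset (Q : cube) : set 'rV[R]_d :=
  [set x | forall i, center Q ord0 i - side Q / 2 <= x ord0 i
                     < center Q ord0 i + side Q / 2].

Definition dilate (l : R) (Q : cube) : cube := (center Q, l * side Q).

Definition vol (Q : cube) : \bar R := lebesgue_rV d (cset Q).

Definition dyadic_system (D : int -> set cube) :=
  (forall k, partition (D k) cset setT /\
             forall Q, D k Q -> side Q = (2 : R) ^ (- k)) /\
  (forall k Q, D (k + 1) Q -> exists2 P, D k P & cset Q `<=` cset P).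

Definition cubes_of (D : int -> set cube) : set cube := \bigcup_k D k.

Definition without_quadrants (D : int -> set cube) :=
  forall P Q, cubes_of D P -> cubes_of D Q ->
  exists2 S, cubes_of D S & cset P `|` cset Q `<=` cset S.

Definition sparse (delta : R) (SS : set cube) :=
  exists E : cube -> set 'rV[R]_d,
    trivIset SS E /\
    forall S, SS S -> [/\ measurable (E S), E S `<=` cset S &
                         (delta%:E * vol S <= lebesgue_rV d (E S))%E].

End cubes.
Arguments cube : clear implicits.

Section boxes.
Context {R : realType}.

Lemma measurable_box d (a b : 'rV[R]_d) :
  measurable [set x : 'rV[R]_d | forall i, a ord0 i <= x ord0 i < b ord0 i].
Proof.
rewrite (_ : mkset _ = \bigcap_(i in [set: 'I_d])
  ((fun x : 'rV[R]_d => x ord0 i : measurableTypeR R) @^-1`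
     `[a ord0 i, b ord0 i[%classic)).
  apply: fin_bigcap_measurable => // i _.
  by rewrite -[X in measurable X]setTI; exact: measurable_coord.
apply/seteqP; split => x /= h i; last by have := h i I; rewrite /= in_itv.
by move=> _; rewrite /= in_itv; exact: h.
Qed.

Lemma lebesgue_rV_box d (a b : 'rV[R]_d) :
  (forall i, a ord0 i <= b ord0 i) ->
  lebesgue_rV d [set x | forall i, a ord0 i <= x ord0 i < b ord0 i] =
  (\prod_i (b ord0 i - a ord0 i))%:E.
Proof.
elim: d a b => [|d IH] a b ab /=.
  by rewrite big_ord0 diracE mem_set// => -[].
rewrite /lebesgue_succ /pushforward /=.
pose a' : 'rV[R]_d := \row_i a ord0 (lift ord0 i).
pose b' : 'rV[R]_d := \row_i b ord0 (lift ord0 i).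
rewrite (_ : _ @^-1` _ = `[a ord0 ord0, b ord0 ord0[%classic `*`
  [set x : 'rV[R]_d | forall i, a' ord0 i <= x ord0 i < b' ord0 i]); last first.
  apply/seteqP; split => [[r v] /= h|[r v] /= [h1 h2] i].
    split=> [|i]; first by have := h ord0; rewrite mxE unlift_none /= in_itv.
    by have := h (lift ord0 i); rewrite !mxE liftK.
  rewrite mxE; case: (unliftP ord0 i) => [j ->|->]/=.
    by have := h2 j; rewrite !mxE.
  by move: h1; rewrite in_itv.
transitivity (@lebesgue_measure R `[a ord0 ord0, b ord0 ord0[%classic *
  lebesgue_rV d [set x : 'rV[R]_d | (forall i, a' ord0 i <= x ord0 i < b' ord0 i)%R])%E.
  by apply: product_measure1E; [exact: measurable_itv|exact: measurable_box].
rewrite IH => [|i]; last by rewrite !mxE.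
rewrite lebesgue_measure_itv/= lte_fin.
rewrite big_ord_recl; under eq_bigr do rewrite !mxE.
case: ltP => h; first by rewrite -EFinB -EFinM.
have -> : b ord0 ord0 = a ord0 ord0 by apply/le_anti; rewrite h ab.
by rewrite subrr mul0e mul0r.
Qed.

Lemma measurable_cset d (Q : cube R d) : measurable (cset Q).
Proof.
rewrite (_ : cset Q = [set x : 'rV[R]_d | forall i,
  (\row_j (center Q ord0 j - side Q / 2)) ord0 i <= x ord0 i <
  (\row_j (center Q ord0 j + side Q / 2)) ord0 i]); first exact: measurable_box.
by apply/seteqP; split => x h i; have := h i; rewrite !mxE.
Qed.

Lemma vol_cube d (Q : cube R d) : 0 <= side Q -> vol Q = (side Q ^+ d)%:E.
Proof.
move=> Q0; rewrite /vol (_ : cset Q = [set x : 'rV[R]_d | forall i,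
  (\row_j (center Q ord0 j - side Q / 2)) ord0 i <= x ord0 i <
  (\row_j (center Q ord0 j + side Q / 2)) ord0 i]); last first.
  by apply/seteqP; split => x h i; have := h i; rewrite !mxE.
rewrite lebesgue_rV_box => [|i]; last first.
  by rewrite !mxE lerD2l (@le_trans _ _ 0)// ?oppr_le0 divr_ge0.
congr EFin; rewrite (eq_bigr (fun=> side Q)) ?prodr_const ?card_ord// => i _.
by rewrite !mxE opprB addrC addrA subrK -splitr.
Qed.

End boxes.

Section strongly_measurable.
Context {R : realType} {d : nat}.
Implicit Types T U : Type.

Definition simple_fun T (s : 'rV[R]_d -> T) :=
  finite_set (range s) /\ forall y, measurable (s @^-1` [set y]).

Definition strongly_measurable (E : normedModType R) (f : 'rV[R]_d -> E) :=
  exists s : nat -> 'rV[R]_d -> E,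
    (forall n, simple_fun (s n)) /\ forall x, s n x @[n --> \oo] --> f x.

Lemma simple_fun_comp T U (phi : T -> U) (s : 'rV[R]_d -> T) :
  simple_fun s -> simple_fun (phi \o s).
Proof.
move=> [fs ms]; split.
  apply: sub_finite_set (finite_image phi fs).
  by move=> _ [x _ <-] /=; exists (s x) => //; exists x.
move=> y; rewrite (_ : _ @^-1` _ =
  \bigcup_(z in range s `&` phi @^-1` [set y]) s @^-1` [set z]).
  by apply: fin_bigcup_measurable => //; exact: sub_finite_set fs.
apply/seteqP; split => [x /= xy|x [z [_ /= zy] /= ->]//].
by exists (s x) => //; split => //; exists x.
Qed.

Lemma simple_fun_pair T U (s : 'rV[R]_d -> T) (u : 'rV[R]_d -> U) :
  simple_fun s -> simple_fun u -> simple_fun (fun x => (s x, u x)).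
Proof.
move=> [fs ms] [fu mu]; split.
  apply: (@sub_finite_set _ _ (range s `*` range u)); last exact: finite_setX.
  by move=> _ [x _ <-]; split; exists x.
move=> [y z]; rewrite (_ : _ @^-1` _ = s @^-1` [set y] `&` u @^-1` [set z]).
  exact: measurableI.
by apply/seteqP; split => x /=; [case=> -> ->|case=> -> ->].
Qed.

Lemma simple_fun_indic (A : set 'rV[R]_d) :
  measurable A -> simple_fun (\1_A : 'rV[R]_d -> R).
Proof.
move=> mA; rewrite (_ : \1_A = (fun b : bool => b%:R) \o (fun x => x \in A)).
  apply: simple_fun_comp; split; first exact: finite_finset.
  move=> [].
    rewrite (_ : _ @^-1` _ = A)//.
    by apply/seteqP; split => x /=; [exact: set_mem|exact: mem_set].
  rewrite (_ : _ @^-1` _ = ~` A); first exact: measurableC.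
  by apply/seteqP; split => x /=; [move/negbT/negP; rewrite inE|exact: memNset].
by apply/funext => x; rewrite /= indicE.
Qed.

Context {E : normedModType R}.
Implicit Types f g : 'rV[R]_d -> E.

Lemma strongly_measurable0 : strongly_measurable (0 : 'rV[R]_d -> E).
Proof.
exists (fun _ => 0); split => [_|x]; last exact: cvg_cst.
split; first by apply: (@sub_finite_set _ _ [set 0]) => // _ [x _ <-].
by move=> y; rewrite [X in measurable X]preimage_cst; case: ifP.
Qed.

Lemma strongly_measurable_lin a f g : strongly_measurable f ->
  strongly_measurable g -> strongly_measurable (a *: f + g).
Proof.
move=> [s [ss sf]] [u [us ug]].
exists (fun n x => a *: s n x + u n x); split.
  move=> n; exact: (simple_fun_comp (fun z => a *: z.1 + z.2)
    (simple_fun_pair (ss n) (us n))).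
by move=> x; apply: cvgD (ug x); exact: cvgZr.
Qed.

Lemma strongly_measurable_indic (A : set 'rV[R]_d) f : measurable A ->
  strongly_measurable f -> strongly_measurable (fun x => \1_A x *: f x).
Proof.
move=> mA [s [ss sf]].
exists (fun n x => \1_A x *: s n x); split.
  move=> n; exact: (simple_fun_comp (fun z => z.1 *: z.2)
    (simple_fun_pair (simple_fun_indic mA) (ss n))).
by move=> x; exact: cvgZr.
Qed.

End strongly_measurable.

Section Linfc.
Context {R : realType}.
Variables (d : nat) (E : normedModType R).

Definition Linfc_pred : {pred 'rV[R]_d -> E} := mem [set f : 'rV[R]_d -> E |
  [/\ strongly_measurable f,
      exists M : R, forall x, `|f x| <= M &
      compact (closure [set x | f x != 0])]].

(* L^oo_c(R^d; E).  Its elements are functions; almost everywhere equal ones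
   are identified by means of the notion of norm below. *)
Record Linfc := MkLinfc {
  Linfc_fun :> 'rV[R]_d -> E;
  Linfc_funP : Linfc_fun \in Linfc_pred }.

HB.instance Definition _ := [isSub for Linfc_fun].
HB.instance Definition _ := gen_eqMixin Linfc.
HB.instance Definition _ := gen_choiceMixin Linfc.

Let compact_closureW (A B : set 'rV[R]_d) :
  A `<=` B -> compact (closure B) -> compact (closure A).
Proof.
move=> AB cB; apply: subclosed_compact cB _; first exact: closed_closure.
exact: closure_subset.
Qed.

Lemma Linfc_submod_closed : submod_closed Linfc_pred.
Proof.
split.
  rewrite inE; split; first exact: strongly_measurable0.
    by exists 0 => x; rewrite normr0.
  rewrite (_ : [set _ | _] = set0) ?closure0; first exact: compact0.
  by apply/seteqP; split => x //=; rewrite eqxx.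
move=> a f g; rewrite !inE => -[mf [M fM] cf] [mg [N gN] cg]; split.
- exact: strongly_measurable_lin.
- exists (`|a| * M + N) => x; rewrite (le_trans (ler_normD _ _))// lerD//.
  by rewrite normrZ ler_wpM2l.
- apply: (@compact_closureW _ ([set x | f x != 0] `|` [set x | g x != 0])).
    move=> x /=; have [fx|] := eqVneq (f x) 0; last by left.
    have [gx|] := eqVneq (g x) 0; last by right.
    have -> : (a *: f + g) x = a *: f x + g x by [].
    by rewrite fx gx scaler0 addr0 eqxx.
  by rewrite closureU; exact: compactU.
Qed.

HB.instance Definition _ := GRing.isSubmodClosed.Build _ _ Linfc_pred
  Linfc_submod_closed.
HB.instance Definition _ := [SubChoice_isSubLmodule of Linfc by <:].

Lemma restr_subproof (Q : cube R d) (f : Linfc) :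
  (fun x => \1_(cset Q) x *: f x) \in Linfc_pred.
Proof.
case: f => f /=; rewrite !inE => -[mf [M fM] cf]; split.
- exact: strongly_measurable_indic (measurable_cset Q) mf.
- exists M => x; rewrite indicE; case: (x \in cset Q); first by rewrite scale1r.
  by rewrite scale0r normr0 (le_trans _ (fM x)).
- apply: compact_closureW cf => x /=.
  by apply: contra => /eqP ->; rewrite scaler0.
Qed.

(* restr Q f is 1_Q f. *)
Definition restr (Q : cube R d) (f : Linfc) : Linfc :=
  MkLinfc (restr_subproof Q f).

(* A norm on the space of almost everywhere classes, viewed as a function on
   the representatives; the first two conditions and N f = 0 for null f force N
   to be nonnegative and constant on each class. *)
Definition is_norm (N : Linfc -> R) :=
  [/\ forall f g, N (f + g) <= N f + N g,
      forall a f, N (a *: f) = `|a| * N f &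
      forall f, N f = 0 <-> {ae lebesgue_rV d, forall x, f x = 0}].

Definition LpNorm (p : \bar R) (f : Linfc) : \bar R :=
  'N[lebesgue_rV d]_p[(fun x => `|f x|%:E)].

(* The linear forms in this ball vanish on null functions, so that they are
   linear forms on the space of classes. *)
Definition dual_ball (N : Linfc -> R) : set {scalar Linfc} :=
  [set phi | forall f, `|phi f| <= N f].

Definition cvx_body (N : Linfc -> R) n (f : 'I_n -> Linfc) : set 'rV[R]_n :=
  [set (\row_i phi (f i))%R | phi in dual_ball N].

End Linfc.

Section products_and_sums.
Context {R : realType}.

(* A . B = [-r, r] is identified with its right endpoint r. *)
Definition dot_set n (A B : set 'rV[R]_n) : R :=
  sup [set \sum_(i < n) ab.1 ord0 i * ab.2 ord0 i | ab in A `*` B].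

(* The sum of an absolutely summable, possibly infinite, real family. *)
Definition rsum (I : choiceType) (J : set I) (a : I -> R) : R :=
  fine (\esum_(j in J) (EFin \o a)^\+ j - \esum_(j in J) (EFin \o a)^\- j)%E.

End products_and_sums.

(* Main.v *)
(* Fix a cube Q and write K, L for the symmetric convex bodies <<f>>_{X(Q)},
   <<g>>_{Y(Q)} in R^n.  Instead of the John ellipsoid of K we use an Auerbach
   system: if u_1, ..., u_n in K almost maximise |det|, then by Cramer's rule
   the dual basis u_i* is bounded on K by any prescribed l > 1.  By Hahn-Banach
   ||f.u_i*||_{X(Q)} is the supremum of u_i* on K, so that
   ||f.u_i*||_{X(Q)} ||g.u_i||_{Y(Q)} <= l (K.L) for every i.  If K spans no
   basis, some combination of the f_i is null and one pair can be split off.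
   With l = sqrt n (for n = 1, l = 1 works directly), applying the hypothesis
   to the n pairs (f.u_i*, g.u_i) and summing gives c n^{3/2} (K.L) |Q|, with as
   exceptional cubes the maximal ones among the n exceptional families, of total
   volume at most n eps |Q|.

   Start from a cube Q_0 containing the supports of all f_i, g_i and iterate on
   the exceptional cubes.  The collection S consists of all cubes met, and E(S)
   is S minus its exceptional cubes.  The remainder after m generations tends to
   0: f and g are bounded, so by the L^p x L^q bound and 1/p + 1/q >= 1 the form
   on a cube Q in Q_0 is O(|Q|), and the m-th generation has volume at most
   (n eps)^m |Q_0|. *)
Require Import Defs.
From HB Require Import structures.
From mathcomp Require Import all_boot all_order all_algebra.
From mathcomp Require Import all_classical all_reals all_analysis.
From mathcomp Require Import perm ring lra.
Set Implicit Arguments.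
Unset Strict Implicit.
Unset Printing Implicit Defensive.
Import Order.TTheory GRing.Theory Num.Theory.
Import numFieldNormedType.Exports.
Local Open Scope classical_set_scope.
Local Open Scope ring_scope.

(** * Hahn-Banach for seminorms *)

Section hahn_banach.
Context {R : realType} {V : lmodType R} (N : V -> R).
Hypothesis N_add : forall u v, N (u + v) <= N u + N v.
Hypothesis N_scale : forall a u, N (a *: u) = `|a| * N u.

Lemma seminorm0 : N 0 = 0.
Proof. by rewrite -(scale0r 0) N_scale normr0 mul0r. Qed.

Lemma seminormN u : N (- u) = N u.
Proof. by rewrite -scaleN1r N_scale normrN1 mul1r. Qed.

Lemma seminorm_ge0 u : 0 <= N u.
Proof.
have := N_add u (- u); rewrite subrr seminorm0 seminormN -mulr2n.
by rewrite pmulrn_lge0.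
Qed.

(** Graphs of partial functionals. Single-valuedness is not imposed, as it follows from linearity
    and domination. The last clause is conditional so that the empty union of an empty chain still
    qualifies in Zorn's lemma. *)
Let dominated_graph (w : V) (G : set (V * R)) :=
  [/\ forall a u r v s, G (u, r) -> G (v, s) -> G (a *: u + v, a * r + s),
      forall u r, G (u, r) -> r <= N u &
      G !=set0 -> G (w, N w)].

Let dominated_graph_bigcup w (F : set (set (V * R))) :
  F `<=` dominated_graph w -> total_on F subset ->
  dominated_graph w (\bigcup_(G in F) G).
Proof.
move=> FP Ftot; split.
- move=> a u r v s [G FG Gu] [K FK Kv].
  have [GK|KG] := Ftot _ _ FG FK.
    by exists K => //; have [+ _ _] := FP _ FK; apply => //; exact: GK.
  by exists G => //; have [+ _ _] := FP _ FG; apply => //; exact: KG.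
- by move=> u r [G FG Gu]; have [_ + _] := FP _ FG; apply.
- by move=> [z [G FG Gz]]; exists G => //; have [_ _ +] := FP _ FG; apply; exists z.
Qed.

Let extend (G : set (V * R)) (v0 : V) (alpha : R) : set (V * R) :=
  [set z | exists u r a, G (u, r) /\ z = (u + a *: v0, r + a * alpha)].

(** From [r + s <= N (u + v) <= N (u - v0) + N (v + v0)], each [r - N (u - v0)] is at most each
    [N (v + v0) - s]; the supremum of the former is an admissible value at [v0]. *)
Let dominated_graph_extend w G v0 : G !=set0 -> dominated_graph w G ->
  exists alpha, dominated_graph w (extend G v0 alpha).
Proof.
move=> [[u0 r0] Gu0] [Glin Gdom Gw].
pose A := [set x | exists u r, G (u, r) /\ x = r - N (u - v0)].
have G00 : G (0, 0).
  have := Glin (- 1) _ _ _ _ Gu0 Gu0.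
  by rewrite scaleN1r mulN1r !addNr.
have Gscale a u r : G (u, r) -> G (a *: u, a * r).
  by move=> Gu; have := Glin a _ _ _ _ Gu G00; rewrite !addr0.
have N_hom b u v : 0 < b -> b * N (b^-1 *: u + v) = N (u + b *: v).
  move=> b0; have {1}-> : b = `|b| by rewrite gtr0_norm.
  by rewrite -N_scale scalerDr scalerA mulfV ?gt_eqF// scale1r.
have A_ub v s : G (v, s) -> ubound A (N (v + v0) - s).
  move=> Gv _ [u [r [Gu ->]]].
  have := Gdom _ _ (Glin 1 _ _ _ _ Gu Gv); rewrite scale1r mul1r.
  have := N_add (u - v0) (v + v0).
  rewrite addrACA addNr addr0; lra.
have A0 : A !=set0 by exists (r0 - N (u0 - v0)), u0, r0.
have A_has_sup : has_sup A by split => //; exists (N (u0 + v0) - r0); exact: A_ub.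
exists (sup A); split.
- move=> b _ _ _ _ [u [r [a [Gu [-> ->]]]]] [v [s [a' [Gv [-> ->]]]]].
  exists (b *: u + v), (b * r + s), (b * a + a'); split; first exact: Glin.
  congr pair; last by ring.
  by rewrite scalerDr scalerA addrACA -scalerDl.
- move=> _ _ [u [r [a [Gu [-> ->]]]]].
  (* Dividing by [|a|] turns the coefficient of [v0] into -1 or 1, and these cases are the lower and
     the upper bound on [sup A]. *)
  have [a0|a0|->] := ltgtP a 0; last by rewrite scale0r mul0r !addr0; exact: Gdom.
    have b0 : 0 < - a by rewrite oppr_gt0.
    have : (- a)^-1 * r - N ((- a)^-1 *: u - v0) <= sup A.
      apply: ub_le_sup; first by case: A_has_sup.
      by exists ((- a)^-1 *: u), ((- a)^-1 * r); split => //; exact: Gscale.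
    rewrite -(ler_pM2l b0) mulrBr mulVKf ?gt_eqF//.
    have := N_hom _ u (- v0) b0; rewrite scalerN scaleNr opprK => ->; lra.
  have : sup A <= N (a^-1 *: u + v0) - a^-1 * r.
    by apply: ge_sup => //; apply: A_ub; exact: Gscale.
  rewrite -(ler_pM2l a0) mulrBr mulVKf ?gt_eqF//.
  rewrite N_hom//; lra.
- move=> _; exists w, (N w), 0; rewrite scale0r mul0r !addr0; split => //.
  by apply: Gw; exists (u0, r0).
Qed.

Lemma hahn_banach_seminorm (w : V) :
  exists2 phi : {scalar V}, forall u, `|phi u| <= N u & phi w = N w.
Proof.
have [G [Gdom Gmax]] := Zorn_bigcup (@dominated_graph_bigcup w).
have [Glin GN Gw] := Gdom.
have G0 : G !=set0.
  (* The empty graph is admissible as well, but the line through [(w, N w)] is strictly larger, so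
     it is not maximal. *)
  apply: contrapT => /set0P/negP/negbNE/eqP GE.
  pose L := [set (a *: w, a * N w) | a in [set: R]].
  apply: (Gmax L).
    rewrite GE; split; first exact: sub0set.
    by move=> /(_ (w, N w)); apply; exists 1 => //; rewrite scale1r mul1r.
  split.
  - move=> a _ _ _ _ [b _ [<- <-]] [c _ [<- <-]]; exists (a * b + c) => //.
    by rewrite scalerDl scalerA mulrDl mulrA.
  - move=> _ _ [a _ [<- <-]]; rewrite N_scale ler_wpM2r ?ler_norm//.
    exact: seminorm_ge0.
  - by move=> _; exists 1 => //; rewrite scale1r mul1r.
have G00 : G (0, 0).
  have [[u r] Gu] := G0.
  by have := Glin (- 1) _ _ _ _ Gu Gu; rewrite scaleN1r mulN1r !addNr.
have Gtotal v : exists r, G (v, r).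
  have [alpha Balpha] := dominated_graph_extend v G0 Gdom.
  apply: contrapT => Gv; apply: (Gmax _ _ Balpha); split.
    move=> [u r] Gu; exists u, r, 0; split => //.
    by rewrite scale0r mul0r !addr0.
  move=> /(_ (v, alpha)) GE; apply: Gv; exists alpha; apply: GE.
  by exists 0, 0, 1; rewrite scale1r mul1r !add0r.
(* Two values at [v] differ by at most [N 0 = 0]. *)
have Guniq v r s : G (v, r) -> G (v, s) -> r = s.
  have le r' s' : G (v, r') -> G (v, s') -> r' <= s'.
    move=> Gr Gs; have := GN _ _ (Glin (- 1) _ _ _ _ Gs Gr).
    by rewrite scaleN1r mulN1r addNr seminorm0 addrC subr_le0.
  by move=> Gr Gs; apply/le_anti; rewrite !le.
pose phi0 (v : V) := projT1 (cid (Gtotal v)).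
have phiG v : G (v, phi0 v) by rewrite /phi0; case: cid.
have phi_lin : scalar phi0.
  move=> a u v; apply: (@Guniq (a *: u + v)) => //; exact: Glin.
pose phiL := GRing.isLinear.Build _ _ _ _ phi0 phi_lin.
pose phi : {scalar V} := HB.pack phi0 phiL.
exists phi => [u|]; last exact: Guniq (phiG w) (Gw G0).
rewrite ler_norml; apply/andP; split; last exact: GN.
rewrite lerNl -(seminormN u) -(linearN phi); exact: GN.
Qed.

End hahn_banach.

(** * Auerbach systems *)

Section bilinear_sums.
Context {R : realType} {V W : lmodType R}.

(** A predicate on plain functions, so that one decomposition serves the form cut off to any cube as
    well as the products [phi u * psi v]. *)
Definition biscalar (b : V -> W -> R) :=
  (forall v, scalar (b^~ v)) /\ (forall u, scalar (b u)).

Variable b : V -> W -> R.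
Hypothesis b_lin : biscalar b.

Let bl v : {scalar V} :=
  HB.pack (b^~ v) (GRing.isLinear.Build _ _ _ _ (b^~ v) (b_lin.1 v)).
Let br u : {scalar W} :=
  HB.pack (b u) (GRing.isLinear.Build _ _ _ _ (b u) (b_lin.2 u)).

Lemma biscalar_suml I (r : seq I) (a : I -> R) u v :
  b (\sum_(i <- r) a i *: u i) v = \sum_(i <- r) a i * b (u i) v.
Proof.
rewrite -[LHS]/(bl v _) linear_sum; apply: eq_bigr => i _.
exact: (linearZ_LR (bl v)).
Qed.

Lemma biscalar_sumr I (r : seq I) (a : I -> R) u v :
  b u (\sum_(i <- r) a i *: v i) = \sum_(i <- r) a i * b u (v i).
Proof.
rewrite -[LHS]/(br u _) linear_sum; apply: eq_bigr => i _.
exact: (linearZ_LR (br u)).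
Qed.

Lemma biscalarBr u v a w : b u (v - a *: w) = b u v - a * b u w.
Proof. by rewrite -scaleNr addrC b_lin.2 addrC mulNr. Qed.

(** Expanding both arguments produces the coefficients [(A *m M) l m], so only the diagonal
    survives. *)
Lemma biscalar_dual_basis n (f : 'I_n -> V) (g : 'I_n -> W) (A M : 'M[R]_n) :
  A *m M = 1%:M ->
  \sum_j b (\sum_l A l j *: f l) (\sum_l M j l *: g l) = \sum_l b (f l) (g l).
Proof.
move=> AM.
transitivity (\sum_l \sum_m (A *m M) l m * b (f l) (g m)).
  rewrite exchange_big/=.
  under eq_bigr do rewrite biscalar_sumr; rewrite exchange_big/=.
  apply: eq_bigr => m _; under eq_bigr do rewrite biscalar_suml.
  under eq_bigr do rewrite mulr_sumr; rewrite exchange_big/=.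
  apply: eq_bigr => l _; rewrite mxE mulr_suml; apply: eq_bigr => j _; ring.
apply: eq_bigr => l _; rewrite AM (bigD1 l)//= mxE eqxx mul1r big1 ?addr0// => m.
by rewrite mxE eq_sym => /negbTE ->; rewrite mul0r.
Qed.

(** Replacing [f k] by the combination adds the terms [e i * b (f i) (g k)] with i different from k,
    and the shift of [g i] removes exactly these. A null combination can thus be isolated in a
    single pair. *)
Lemma biscalar_eliminate n (f : 'I_n.+1 -> V) (g : 'I_n.+1 -> W)
    (e : 'I_n.+1 -> R) k : e k = 1 ->
  \sum_i b (f i) (g i) = b (\sum_i e i *: f i) (g k) +
    \sum_i b (f (lift k i)) (g (lift k i) - e (lift k i) *: g k).
Proof.
move=> ek; rewrite (bigD1_ord k)//= biscalar_suml (bigD1_ord k)//= ek mul1r.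
rewrite -addrA -big_split/=; congr (_ + _); apply: eq_bigr => i _.
rewrite biscalarBr; ring.
Qed.

End bilinear_sums.

(** * Functionals with almost maximal determinant *)

Section auerbach.
Context {R : realType}.

Definition dual_unit_ball {V : lmodType R} (N : V -> R) : set {scalar V} :=
  [set phi | forall u, `|phi u| <= N u].

Definition seminorm {V : lmodType R} (N : V -> R) :=
  (forall u v, N (u + v) <= N u + N v) /\ (forall a u, N (a *: u) = `|a| * N u).

Definition pairing_mx {V : lmodType R} m n (phi : 'I_m -> {scalar V})
  (f : 'I_n -> V) : 'M[R]_(m, n) := \matrix_(i, j) phi i (f j).

Section one_space.
Context {V : lmodType R} {N : V -> R} (N_semi : seminorm N).

Variables (n : nat) (f : 'I_n -> V).
Hypothesis f_free : forall e : 'I_n -> R,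
  N (\sum_i e i *: f i) = 0 -> forall i, e i = 0.

(** With fewer than n functionals, some nonzero vector e is killed by all rows of the pairing
    matrix. A functional norming the combination of the [f i] with coefficients e does not vanish
    there, by freeness, so its row is independent of the earlier ones. *)
Lemma exists_row_free_pairing k : (k <= n)%N ->
  exists2 phi : 'I_k -> {scalar V}, forall i, dual_unit_ball N (phi i) &
    row_free (pairing_mx phi f).
Proof.
elim: k => [_|k IH kn].
  exists (fun _ => \0 : {scalar V}); first by case.
  by rewrite /row_free eqn_leq rank_leq_row.
have [phi phiB phi_free] := IH (ltnW kn).
set M := pairing_mx phi f in phi_free.
(* Fewer rows than columns: the cokernel is nonzero, and any nonzero column of it is the vector
   e. *)
have M_ncofree : cokermx M != 0.
  rewrite -mxrank_eq0 mxrank_coker subn_eq0 -ltnNge.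
  by rewrite (leq_ltn_trans (rank_leq_row _)).
have [j colj] : exists j, col j (cokermx M) != 0.
  apply: contrapT => /forallNP h; move/eqP: M_ncofree; apply.
  apply/matrixP => i j; have /negP/negbNE/eqP := h j.
  by move/matrixP/(_ i 0); rewrite !mxE.
set e := col j (cokermx M) in colj.
have Me : M *m e = 0 by rewrite /e colE mulmxA mulmx_coker mul0mx.
have [phi0 phi0B phi0E] := hahn_banach_seminorm N_semi.1 N_semi.2
  (\sum_i e i 0 *: f i).
pose v := \row_j phi0 (f j).
have ve : v *m e != 0.
  apply/negP => /eqP/matrixP/(_ 0 0); rewrite !mxE => ve0.
  move/eqP: colj; apply; apply/colP => i; rewrite [RHS]mxE.
  apply: (f_free (e := e^~ 0)); rewrite -phi0E.
  rewrite (linear_sum phi0) -[RHS]ve0; apply: eq_bigr => l _.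
  by rewrite (linearZ_LR phi0) !mxE mulrC.
have vM : ~~ (v <= M)%MS.
  apply: contra ve => /submxP[w ->]; by rewrite -mulmxA Me mulmx0.
exists (fun i => oapp phi phi0 (unlift ord0 i)).
  by move=> i; case: unliftP => [i'|] _ //=; exact: phi0B.
have -> : pairing_mx (fun i => oapp phi phi0 (unlift ord0 i)) f =
    (col_mx v M : 'M[R]_(1 + k, n)).
  apply/matrixP => i l; rewrite mxE.
  case: (unliftP ord0 i) => [i' ->|->] /=.
    have -> : lift ord0 i' = rshift 1 i' by exact: val_inj.
    by apply: etrans (esym (col_mxEd v M i' l)); rewrite mxE.
  have -> : ord0 = @lshift 1 k ord0 :> 'I_(1 + k) by exact: val_inj.
  by apply: etrans (esym (col_mxEu v M ord0 l)); rewrite mxE.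
suff : \rank (col_mx v M) == (1 + k)%N by [].
rewrite eqn_leq rank_leq_row -addsmxE add1n /=.
suff : (\rank M < \rank (v + M)%MS)%N by rewrite (eqP phi_free).
by apply: rank_ltmx; rewrite /ltmx addsmxSr /= addsmx_sub submx_refl andbT.
Qed.

Lemma det_pairing_le : exists C : R, forall phi : 'I_n -> {scalar V},
  (forall i, dual_unit_ball N (phi i)) -> `|\det (pairing_mx phi f)| <= C.
Proof.
exists (\sum_(s : {perm 'I_n}) \prod_i N (f (s i))) => phi phiB.
rewrite /determinant (le_trans (ler_norm_sum _ _ _))// ler_sum// => s _.
rewrite normrM normrX normrN1 expr1n mul1r normr_prod ler_prod// => i _.
by rewrite normr_ge0/= mxE; exact: phiB.
Qed.

(* Take phi almost maximising |det (phi_i (f_j))| and use Cramer's rule. *)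
Lemma auerbach_system (l : R) : 1 < l ->
  exists phi : 'I_n -> {scalar V},
    [/\ forall i, dual_unit_ball N (phi i), pairing_mx phi f \in unitmx &
        forall j, N (\sum_i (invmx (pairing_mx phi f)) i j *: f i) <= l].
Proof.
move=> l1; have l0 : 0 < l by rewrite (lt_trans ltr01).
pose Phi : set ('I_n -> {scalar V}) := [set phi | forall i, dual_unit_ball N (phi i)].
pose D := [set `|\det (pairing_mx phi f)| | phi in Phi].
have [phi0 phi0B] := exists_row_free_pairing (leqnn n).
rewrite row_free_unit unitmxE unitfE -normr_gt0 => det0.
have [C CD] := det_pairing_le.
have Dsup : has_sup D.
  split; first by exists `|\det (pairing_mx phi0 f)|, phi0.
  by exists C => _ [phi phiB <-]; exact: CD.
have S0 : 0 < sup D.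
  by rewrite (lt_le_trans det0)// ub_le_sup//; [case: Dsup|exists phi0].
(* This margin yields [|det M| > sup D / l]. *)
have lS : 0 < sup D - sup D / l.
  by rewrite subr_gt0 ltr_pdivrMr// ltr_pMr.
have [_ [phi phiB <-]] := sup_adherent lS Dsup; rewrite opprB addrC subrK => lphi.
set M := pairing_mx phi f in lphi *.
have dM : 0 < `|\det M| by rewrite (le_lt_trans _ lphi)// divr_ge0 ?ltW.
have uM : M \in unitmx by rewrite unitmxE unitfE -normr_gt0.
exists phi; split => // j.
have [phi' phi'B phi'E] := hahn_banach_seminorm N_semi.1 N_semi.2
  (\sum_i (invmx M) i j *: f i).
rewrite -phi'E (le_trans (ler_norm _))//.
(* Putting the norming functional in row j keeps the family in the unit ball and leaves the
   cofactors of that row unchanged. Expansion along it gives a quotient of determinants, at most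
   [sup D / |det M|]. *)
pose chi i := if i == j then phi' else phi i.
have chiB : Phi chi by move=> i; rewrite /chi; case: eqP.
have -> : phi' (\sum_i (invmx M) i j *: f i) =
    \det (pairing_mx chi f) / \det M.
  rewrite (linear_sum phi') (expand_det_row _ j) mulr_suml; apply: eq_bigr => i _.
  have -> : cofactor (pairing_mx chi f) j i = cofactor M j i.
    congr (_ * \det _); apply/matrixP => x y; rewrite !mxE /chi.
    by rewrite eq_sym (negbTE (neq_lift _ _)).
  have -> : invmx M i j = (\det M)^-1 * cofactor M j i.
    by rewrite /invmx uM !mxE.
  by rewrite linearZ_LR /= mxE /chi eqxx mulrC mulrCA mulrC -mulrA.
rewrite normrM normfV ler_pdivrMr// -ler_pdivrMl// mulrC.
by rewrite ltW// (le_lt_trans _ lphi)// ler_pM2r ?invr_gt0// ub_le_sup//;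
  [case: Dsup|exists chi].
Qed.

End one_space.
End auerbach.

(** * Decomposition into pairs with controlled norms *)

Section auerbach_pair.
Context {R : realType} {V W : lmodType R} {N : V -> R} {P : W -> R}.
Hypotheses (N_semi : seminorm N) (P_semi : seminorm P).

(** An upper bound for the dot product of the two bodies, phrased through functionals so that it
    passes to transformed families. *)
Definition pairing_bound n (f : 'I_n -> V) (g : 'I_n -> W) (B : R) :=
  forall (phi : {scalar V}) (psi : {scalar W}), dual_unit_ball N phi ->
    dual_unit_ball P psi -> \sum_i phi (f i) * psi (g i) <= B.

Lemma biscalar_tensor (phi : {scalar V}) (psi : {scalar W}) :
  biscalar (fun u v => phi u * psi v).
Proof.
split=> [v a x y|u a x y]; first by rewrite linearP /= mulrDl mulrA.
by rewrite linearP /= mulrDr mulrCA.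
Qed.

Let N_ge0 : forall u, 0 <= N u := seminorm_ge0 N_semi.1 N_semi.2.
Let P_ge0 : forall u, 0 <= P u := seminorm_ge0 P_semi.1 P_semi.2.

Lemma pairing_bound_ge0 n (f : 'I_n -> V) (g : 'I_n -> W) B :
  pairing_bound f g B -> 0 <= B.
Proof.
move=> /(_ (\0 : {scalar V}) (\0 : {scalar W})) /=.
rewrite big1 => [|i _]; last by rewrite mul0r.
by apply => u; rewrite normr0.
Qed.

(** Induction on n handles families with a combination of seminorm zero, one pair being split off at
    no cost. Free families are treated directly: by norming functionals if n = 1, by an Auerbach
    system if n is at least 2. *)
Lemma auerbach_pair n (f : 'I_n -> V) (g : 'I_n -> W) B : pairing_bound f g B ->
  exists F : 'I_n -> V, exists G : 'I_n -> W,
    (forall b, biscalar b -> \sum_i b (f i) (g i) = \sum_i b (F i) (G i)) /\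
    forall i, N (F i) * P (G i) <= Num.sqrt n%:R * B.
Proof.
elim: n f g => [|n IH] f g fgB; first by exists f, g; split => // -[].
have B0 := pairing_bound_ge0 fgB.
have [[e [k [ek0 Ne0]]]|f_free] := pselect (exists e : 'I_n.+1 -> R, exists k,
    e k != 0 /\ N (\sum_i e i *: f i) = 0).
  pose e1 i := e i / e k.
  have e1k : e1 k = 1 by rewrite /e1 mulfV.
  set h := \sum_i e1 i *: f i.
  have h0 : N h = 0.
    have -> : h = (e k)^-1 *: (\sum_i e i *: f i).
      rewrite scaler_sumr; apply: eq_bigr => i _.
      by rewrite scalerA mulrC.
    by rewrite N_semi.2 Ne0 mulr0.
  pose f' i := f (lift k i); pose g' i := g (lift k i) - e1 (lift k i) *: g k.
  have [|F [G [bFG NPB]]] := IH f' g'.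
    move=> phi psi phiB psiB; have := fgB phi psi phiB psiB.
    rewrite (biscalar_eliminate (biscalar_tensor phi psi) f g e1k) -/h.
    (* Functionals in the ball vanish on [h], so the remaining pairs inherit the same bound [B]. *)
    have : `|phi h| <= 0 by rewrite -h0; exact: phiB.
    by rewrite normr_le0 => /eqP ->; rewrite mul0r add0r.
  exists (fun i => oapp F h (unlift k i)), (fun i => oapp G (g k) (unlift k i)).
  split=> [b b_lin|i].
    rewrite (biscalar_eliminate b_lin f g e1k) -/h bFG// (bigD1_ord k)//=.
    rewrite unlift_none /=; congr (_ + _); apply: eq_bigr => i _.
    by rewrite liftK.
  case: unliftP => [i'|] _ /=; last by rewrite h0 mul0r mulr_ge0// sqrtr_ge0.
  by rewrite (le_trans (NPB i'))// ler_wpM2r// ler_wsqrtr// ler_nat.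
have {}f_free (e : 'I_n.+1 -> R) : N (\sum_i e i *: f i) = 0 -> forall i, e i = 0.
  move=> Ne0 i; apply: contrapT => /eqP ei0; apply: f_free; by exists e, i.
(* For one pair [sqrt 1 = 1] leaves no room for an almost maximal determinant, but norming
   functionals of [f 0] and [g 0] give the bound at once. *)
case: n IH f g fgB f_free => [|n] IH f g fgB f_free.
  exists f, g; split=> // i; rewrite ord1.
  have [phi phiB <-] := hahn_banach_seminorm N_semi.1 N_semi.2 (f 0).
  have [psi psiB <-] := hahn_banach_seminorm P_semi.1 P_semi.2 (g 0).
  by have := fgB phi psi phiB psiB; rewrite big_ord1 sqrtr1 mul1r.
have [|phi [phiB Mu NF]] := @auerbach_system _ _ _ N_semi _ _ f_free
    (Num.sqrt n.+2%:R).
  by rewrite -[ltLHS]sqrtr1 ltr_sqrt// ltr1n.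
set M := pairing_mx phi f in Mu NF.
exists (fun j => \sum_l (invmx M) l j *: f l), (fun j => \sum_l M j l *: g l).
split=> [b b_lin|j]; first by rewrite biscalar_dual_basis ?mulVmx.
apply: ler_pM => //.
(* For [psi] norming the j-th new vector, its value is the sum of [phi j (f l) * psi (g l)] over l,
   which is at most [B]. *)
have [psi psiB <-] := hahn_banach_seminorm P_semi.1 P_semi.2 (\sum_l M j l *: g l).
rewrite linear_sum /= (le_trans _ (fgB (phi j) psi (phiB j) psiB))//.
by apply: ler_sum => i _; rewrite linearZ_LR /= mxE.
Qed.

End auerbach_pair.

(** * Dyadic cubes *)

Section dyadic_cubes.
Context {R : realType} {d : nat} (D : int -> set (cube R d)).
Hypothesis D_dyadic : dyadic_system D.
Implicit Types (P Q K : cube R d) (A : set (cube R d)).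

Lemma dyadic_side k Q : D k Q -> side Q = (2 : R) ^ (- k).
Proof. by have [_] := D_dyadic.1 k; apply. Qed.

Lemma dyadic_trivIset k : trivIset (D k) cset.
Proof. by have [[]] := D_dyadic.1 k. Qed.

Lemma dyadic_cover k x : exists2 Q, D k Q & cset Q x.
Proof.
have [[cov _ _] _] := D_dyadic.1 k.
have : cover (D k) cset x by rewrite cov.
by move=> [Q DQ Qx]; exists Q.
Qed.

Lemma side_gt0 Q : cubes_of D Q -> 0 < side Q.
Proof. by move=> [k _ DQ]; rewrite (dyadic_side DQ) exprz_gt0. Qed.

Lemma cset_center Q : 0 < side Q -> cset Q (Defs.center Q).
Proof.
by move=> Q0 i; rewrite gerBl ltrDl divr_gt0// divr_ge0 ?ltW.
Qed.

Lemma dyadic_vol Q : cubes_of D Q -> vol Q = (side Q ^+ d)%:E.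
Proof. by move=> /side_gt0/ltW; exact: vol_cube. Qed.

Lemma vol_gt0 Q : cubes_of D Q -> (0 < vol Q)%E.
Proof.
by move=> DQ; rewrite dyadic_vol// lte_fin exprn_gt0// side_gt0.
Qed.

Lemma vol_fin_num Q : cubes_of D Q -> vol Q \is a fin_num.
Proof. by move=> /dyadic_vol ->. Qed.

Lemma le_vol P Q : cset P `<=` cset Q -> (vol P <= vol Q)%E.
Proof.
by move=> PQ; rewrite /vol le_measure// inE; exact: measurable_cset.
Qed.

Lemma dyadic_ancestor (m : nat) k P : D (k + m%:Z) P ->
  exists2 Q, D k Q & cset P `<=` cset Q.
Proof.
elim: m P => [|m IH] P; first by rewrite addr0 => DP; exists P.
rewrite intS (addrC 1) addrA => /D_dyadic.2[Q /IH[K DK QK] PQ].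
by exists K => //; exact: subset_trans QK.
Qed.

Lemma dyadic_nested j k P Q : D j P -> D k Q -> k <= j ->
  cset P `&` cset Q !=set0 -> cset P `<=` cset Q.
Proof.
move=> DP DQ kj [x [Px Qx]].
have [m jE] : exists m : nat, j = k + m%:Z.
  by exists `|j - k|%N; rewrite gez0_abs ?subr_ge0// addrCA subrr addr0.
rewrite jE in DP.
have [K DK PK] := dyadic_ancestor DP.
suff -> : Q = K by [].
by apply: dyadic_trivIset DQ DK _; exists x; split => //; exact: PK.
Qed.

Lemma cubes_nested P Q : cubes_of D P -> cubes_of D Q ->
  cset P `&` cset Q !=set0 -> cset P `<=` cset Q \/ cset Q `<=` cset P.
Proof.
move=> [j _ DP] [k _ DQ] PQ; have [kj|jk] := leP k j.
  by left; exact: (dyadic_nested DP DQ kj PQ).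
by right; apply: (dyadic_nested DQ DP (ltW jk)); rewrite setIC.
Qed.

(** Volumes are compared, and d > 0 matters here: for d = 0 every cube has volume 1, whatever its
    level. *)
Lemma dyadic_level_le j k P Q : (0 < d)%N -> D j P -> D k Q ->
  cset P `<=` cset Q -> k <= j.
Proof.
move=> d0 DP DQ PQ; have := le_vol PQ.
have [cP cQ] : cubes_of D P /\ cubes_of D Q by split; [exists j|exists k].
have [P0 Q0] := (ltW (side_gt0 cP), ltW (side_gt0 cQ)).
rewrite !dyadic_vol// lee_fin ler_pXn2r ?nnegrE//.
by rewrite (dyadic_side DP) (dyadic_side DQ) ler_eXz2l ?ltr1n// lerN2.
Qed.

(** A cube is coded by the integer parts of its center measured in side lengths. Equal codes put the
    centers less than one side apart in each coordinate, so the cubes meet and hence coincide. *)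
Lemma countable_dyadic k : countable (D k).
Proof.
pose z Q : {ffun 'I_d -> int} := [ffun i => Num.floor (Defs.center Q ord0 i / side Q)].
apply/countable_injP; exists (pickle \o z) => P Q.
rewrite !inE => DP DQ /(pcan_inj pickleK)/ffunP zPQ.
have [P0 Q0] : 0 < side P /\ 0 < side Q by split; apply: side_gt0; exists k.
have sPQ : side P = side Q by rewrite (dyadic_side DP) (dyadic_side DQ).
have close i : Defs.center P ord0 i < Defs.center Q ord0 i + side Q /\
               Defs.center Q ord0 i < Defs.center P ord0 i + side Q.
  have := zPQ i; rewrite !ffunE sPQ.
  set a := _ / _; set b := _ / _ => ab.
  have aE : Defs.center P ord0 i = a * side Q by rewrite /a mulfVK// gt_eqF.
  have bE : Defs.center Q ord0 i = b * side Q by rewrite /b mulfVK// gt_eqF.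
  have /andP[a1 a2] := floor_itv a; have /andP[b1 b2] := floor_itv b.
  rewrite ab in a1 a2; rewrite intrD in a2 b2.
  rewrite aE bE; split; rewrite -[X in _ + X]mul1r -mulrDl ltr_pM2r//; lra.
apply: dyadic_trivIset DP DQ _.
(* The lower corner of the intersection of the two half-open boxes. *)
exists (\row_i (Num.max (Defs.center P ord0 i) (Defs.center Q ord0 i) - side Q / 2)).
split=> i; rewrite mxE ?sPQ; have [] := close i;
  case: (leP (Defs.center P ord0 i) (Defs.center Q ord0 i)) => h c1 c2;
  apply/andP; split; lra.
Qed.

Lemma countable_cubes : countable (cubes_of D).
Proof. by apply: bigcup_countable => // k _; exact: countable_dyadic. Qed.

Lemma measurable_bigcup_cubes A : A `<=` cubes_of D ->
  measurable (\bigcup_(K in A) cset K).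
Proof.
move=> AD; have : countable A.
  by apply: sub_countable countable_cubes; exact: subset_card_le.
move=> /countable_injP[h hinj].
rewrite (_ : \bigcup_(K in A) cset K =
  \bigcup_(m in h @` A) \bigcup_(K in A `&` h @^-1` [set m]) cset K).
  apply: bigcup_measurable => _ [K AK <-].
  rewrite (_ : A `&` _ = [set K]) ?bigcup_set1; first exact: measurable_cset.
  apply/seteqP; split => [P [AP /= hPK]|_ ->//].
  by apply: hinj => //; rewrite inE.
apply/seteqP; split => [x [K AK Kx]|x [_ _ [K [AK _] Kx]]]; last by exists K.
by exists (h K); [exists K|exists K].
Qed.

Lemma measure_bigcup_cubes A : A `<=` cubes_of D -> trivIset A cset ->
  lebesgue_rV d (\bigcup_(K in A) cset K) = \esum_(K in A) vol K.
Proof.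
move=> AD tA; have : countable A.
  by apply: sub_countable countable_cubes; exact: subset_card_le.
move=> /countable_injP[h hinj].
(* The partial inverse of the enumeration needs a default cube [K0], hence the separate empty
   case. *)
have [->|/set0P[K0 AK0]] := eqVneq A set0.
  by rewrite bigcup_set0 measure0 esum_set0.
pose h' := 'pinv_(cst K0) A h.
have h'K : {in A, cancel h h'} by exact: pinvKV.
have Abij : set_bij (h @` A) A h'.
  split.
  - by move=> _ [K AK <-]; rewrite h'K ?inE.
  - move=> x y; rewrite !inE => -[K AK <-] [L AL <-].
    by rewrite !h'K ?inE// => ->.
  - by move=> K AK; exists (h K); [exists K|rewrite h'K ?inE].
rewrite (reindex_esum _ _ _ _ Abij).
rewrite (_ : \bigcup_(K in A) cset K = \bigcup_(m in h @` A) cset (h' m)).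
  have tA' : trivIset (h @` A) (fun m => cset (h' m)).
    move=> _ _ [K AK <-] [L AL <-]; rewrite !h'K ?inE//.
    by move=> KL; congr h; exact: tA KL.
  rewrite measure_bigcup// => [|m _]; last exact: measurable_cset.
  by rewrite nneseries_esum// set_mem_set.
apply/seteqP; split => [x [K AK Kx]|x [_ [K AK <-]]].
  by exists (h K); [exists K|rewrite h'K ?inE].
by rewrite h'K ?inE// => Kx; exists K.
Qed.

End dyadic_cubes.

(** * Unordered sums *)

Section esum_lemmas.
Context {R : realType} {T : choiceType}.
Local Open Scope ereal_scope.
Implicit Types (A B : set T) (a b : T -> \bar R).

Lemma esum_subset A B a : A `<=` B -> \esum_(i in A) a i <= \esum_(i in B) a i.
Proof.
move=> AB; apply: ge_ereal_sup => _ [F [finF FA] <-].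
by apply: ereal_sup_ubound; exists F => //; split => //; exact: subset_trans AB.
Qed.

Lemma esumZl_le A (r : R) a : (0 <= r)%R -> (forall i, A i -> 0 <= a i) ->
  \esum_(i in A) (r%:E * a i) <= r%:E * \esum_(i in A) a i.
Proof.
move=> r0 a0; apply: ge_ereal_sup => _ [F [finF FA] <-].
(* Extension by zero outside [A] makes the summand nonnegative everywhere, as needed to pull the
   scalar out of the finite sum. *)
rewrite (eq_fsbigr (fun i => r%:E * (if i \in A then a i else 0))); last first.
  by move=> i; rewrite inE => /FA Ai; rewrite mem_set.
rewrite -ge0_mule_fsumr; last by move=> i; case: ifP => //; rewrite inE => /a0.
apply: lee_wpmul2l; first by rewrite lee_fin.
rewrite (eq_fsbigr a); last by move=> i; rewrite inE => /FA Ai; rewrite mem_set.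
by apply: ereal_sup_ubound; exists F.
Qed.

Lemma esum_bigcup_le n (A : 'I_n -> set T) a : (forall i, 0 <= a i) ->
  \esum_(i in \bigcup_k A k) a i <= \sum_(k < n) \esum_(i in A k) a i.
Proof.
move=> a0; rewrite esum_mkcond; under eq_bigr do rewrite esum_mkcond.
rewrite -esum_sum; last by move=> i k _ _; case: ifP.
apply: le_esum => i _; case: ifPn => [|_].
  rewrite inE => -[k _ Aki]; rewrite (bigD1 k)//= mem_set// leeDl//.
  by apply: sume_ge0 => j _; case: ifP.
by apply: sume_ge0 => j _; case: ifP.
Qed.

(** Disjointness of the sets [J k] makes the second projection injective on the pairs (k, i), so no
    term is counted twice. *)
Lemma esum_esum_le (S : choiceType) (I : set S) (J : S -> set T) B a :
  (forall i, B i -> 0 <= a i) -> (forall k, I k -> J k `<=` B) ->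
  trivIset I J ->
  \esum_(k in I) \esum_(i in J k) a i <= \esum_(i in B) a i.
Proof.
move=> a0 JB tJ; rewrite esum_esum; last by move=> k i Ik /(JB k Ik)/a0.
have e_inj : set_inj (I `*`` J) (fun z : S * T => z.2).
  move=> [k i] [l j]; rewrite !inE => -[/= Ik Jki] [/= Il Jlj] ij.
  by rewrite -ij in Jlj *; congr pair; apply: tJ => //; exists i.
rewrite -(esum_image _ _ _ e_inj); apply: esum_subset => _ [[k i] [/= Ik Jki] <-].
exact: JB Jki.
Qed.

End esum_lemmas.

(** * Signed sums of summable families *)

Section rsum_lemmas.
Context {R : realType} {T : choiceType}.
Variable J : set T.
Implicit Types a b : T -> R.
Local Open Scope ereal_scope.

Let summable_pos a : summable J (EFin \o a) ->
  \esum_(i in J) (EFin \o a)^\+ i \is a fin_num.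
Proof.
move=> /summable_funepos; rewrite summableE.
by under eq_esum do rewrite gee0_abs ?funepos_ge0//.
Qed.

Let summable_neg a : summable J (EFin \o a) ->
  \esum_(i in J) (EFin \o a)^\- i \is a fin_num.
Proof.
move=> /summable_funeneg; rewrite summableE.
by under eq_esum do rewrite gee0_abs ?funeneg_ge0//.
Qed.

(** The positive part of a sum is not the sum of the positive parts. Instead [a + b] is written as
    the difference of [a^+ + b^+] and [a^- + b^-], and [esumB] allows any such nonnegative
    decomposition. *)
Lemma rsumD a b : summable J (EFin \o a) -> summable J (EFin \o b) ->
  rsum J (a \+ b)%R = (rsum J a + rsum J b)%R.
Proof.
move=> sa sb; rewrite /rsum.
have -> : EFin \o (a \+ b)%R = (EFin \o a) \+ (EFin \o b) by [].
rewrite funeD_posD esumB.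
- rewrite !esumD; do ?by move=> i _; rewrite ?funepos_ge0 ?funeneg_ge0.
  rewrite -fineD ?fin_numB ?summable_pos ?summable_neg//.
  by rewrite fin_num_oppeD ?summable_neg// addeACA.
- by apply: summableD; exact: summable_funepos.
- by apply: summableD; exact: summable_funeneg.
- by move=> i _; rewrite adde_ge0 ?funepos_ge0.
- by move=> i _; rewrite adde_ge0 ?funeneg_ge0.
Qed.

Lemma rsum0 : rsum J (fun _ => 0 : R)%R = 0%R.
Proof.
rewrite /rsum !esum1 ?subee// => i _; first by rewrite funenegE /= oppr0 maxxx.
by rewrite funeposE /= maxxx.
Qed.

Lemma summable_sum I (r : seq I) (a : I -> T -> R) :
  (forall i, summable J (EFin \o a i)) ->
  summable J (EFin \o (fun j => \sum_(i <- r) a i j)%R).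
Proof.
move=> sa; elim: r => [|i r IH].
  rewrite /summable esum1 ?ltry// => j _ /=.
  by rewrite big_nil normr0.
have -> : EFin \o (fun j => \sum_(k <- i :: r) a k j)%R =
    (EFin \o a i) \+ (EFin \o (fun j => \sum_(k <- r) a k j)%R).
  by apply/funext => j /=; rewrite big_cons.
exact: summableD.
Qed.

Lemma rsum_sum I (r : seq I) (a : I -> T -> R) :
  (forall i, summable J (EFin \o a i)) ->
  rsum J (fun j => \sum_(i <- r) a i j)%R = (\sum_(i <- r) rsum J (a i))%R.
Proof.
move=> sa; elim: r => [|i r IH].
  by rewrite big_nil -[RHS]rsum0; congr rsum; apply/funext => j; rewrite big_nil.
rewrite big_cons -IH -rsumD//; last exact: summable_sum.
by congr rsum; apply/funext => j; rewrite big_cons.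
Qed.

Lemma abs_rsum_le a : summable J (EFin \o a) ->
  `|rsum J a|%:E <= \esum_(j in J) `|a j|%:E.
Proof.
move=> sa; rewrite /rsum fineB ?summable_pos ?summable_neg//.
have -> : \esum_(j in J) `|a j|%:E =
    \esum_(j in J) ((EFin \o a)^\+ j + (EFin \o a)^\- j).
  apply: eq_esum => j _.
  by rewrite -[RHS]/(((EFin \o a)^\+ \+ (EFin \o a)^\-) j) -fune_abse.
rewrite esumD; do ?by move=> i _; rewrite ?funepos_ge0 ?funeneg_ge0.
rewrite -[X in _ <= X + _]fineK ?summable_pos//.
rewrite -[X in _ <= _ + X]fineK ?summable_neg//.
rewrite lee_fin (le_trans (ler_normB _ _))// !ger0_norm//.
all: by rewrite fine_ge0// esum_ge0// => i _; rewrite ?funepos_ge0 ?funeneg_ge0.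
Qed.

End rsum_lemmas.

(** * Local size of the bilinear form *)

(** The integral of a nonnegative function is a supremum over simple functions below it. This spares
    a proof that the norm of a strongly measurable function is measurable. *)
Lemma ge0_le_integralT d (T : measurableType d) (R : realType)
    (mu : {measure set T -> \bar R}) (f g : T -> \bar R) :
  (forall x, 0 <= f x)%E -> (forall x, f x <= g x)%E ->
  (\int[mu]_x f x <= \int[mu]_x g x)%E.
Proof.
move=> f0 fg; have g0 x : (0 <= g x)%E := le_trans (f0 x) (fg x).
rewrite !ge0_integralTE//; apply: le_ereal_sup => _ [h hf <-].
by exists h => // x; exact: le_trans (fg x).
Qed.

Section restriction.
Context {R : realType} {d : nat} {E : normedModType R}.
Implicit Types (f g : Linfc d E) (Q : cube R d).

Lemma Linfc_ext f g : (forall x, f x = g x) -> f = g.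
Proof. by move=> fg; apply/val_inj/funext. Qed.

Lemma restrE Q f x : restr Q f x = \1_(cset Q) x *: f x.
Proof. by []. Qed.

Lemma restr_linear Q a f g : restr Q (a *: f + g) = a *: restr Q f + restr Q g.
Proof.
apply: Linfc_ext => x; rewrite restrE.
have lin (u v : Linfc d E) : (a *: u + v) x = a *: u x + v x by [].
by rewrite !lin !restrE scalerDr !scalerA mulrC.
Qed.

Lemma restr_id Q f : (forall x, f x != 0 -> cset Q x) -> restr Q f = f.
Proof.
move=> fQ; apply: Linfc_ext => x; rewrite restrE.
have [->|/fQ Qx] := eqVneq (f x) 0; first by rewrite scaler0.
by rewrite indicE mem_set// scale1r.
Qed.

Lemma Linfc_bounded f : exists2 M : R, 0 <= M & forall x, `|f x| <= M.
Proof.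
have := Linfc_funP f; rewrite inE => -[_ [M fM] _].
by exists M => //; exact: le_trans (normr_ge0 _) (fM 0).
Qed.

(** At [p = +oo] the exponent [fine p^-1] is 0 and the bound reads [M], so one formula also covers
    the essential supremum. *)
Lemma LpNorm_restr_le (p : \bar R) Q f (M : R) : (1 <= p)%E -> 0 <= side Q ->
  (forall x, `|f x| <= M) ->
  (LpNorm p (restr Q f) <= (M * (side Q ^+ d) `^ fine p^-1)%:E)%E.
Proof.
move=> p1 Q0 fM; have M0 : 0 <= M by rewrite (le_trans _ (fM 0)).
have rM x : `|restr Q f x| <= M.
  rewrite restrE normrZ indicE; case: (_ \in _); first by rewrite normr1 mul1r.
  by rewrite normr0 mul0r.
rewrite /LpNorm unlock; case: p p1 => [r|_|//].
  rewrite lee_fin => r1; have r0 : 0 < r by rewrite (lt_le_trans ltr01).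
  rewrite inver gt_eqF//=.
  have : (\int[lebesgue_rV d]_x ((abse `|restr Q f x|%:E) `^ r) <=
          (M `^ r)%:E * vol Q)%E.
    rewrite -integral_cst; last exact: measurable_cset.
    rewrite [leRHS]integral_mkcond; apply: ge0_le_integralT => x.
      exact: poweR_ge0.
    rewrite /patch; case: ifPn => [_|xQ].
      rewrite /= lee_fin normr_id; apply: ge0_ler_powR (rM x);
        rewrite ?nnegrE ?normr_ge0 ?M0 ?(ltW r0) //.
    by rewrite restrE indicE (negbTE xQ) scale0r normr0 /= normr0 powR0// gt_eqF.
  move=> /(@gt0_ler_poweR _ r^-1); rewrite !in_itv /= !leey !andbT.
  rewrite invr_ge0 (ltW r0) => /(_ isT) h.
  apply: le_trans (h _ _) _.
  - by rewrite integral_ge0// => x _; exact: poweR_ge0.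
  - by rewrite mule_ge0// lee_fin powR_ge0.
  rewrite vol_cube// -EFinM poweR_EFin lee_fin powRM ?powR_ge0 ?exprn_ge0//.
  by rewrite -powRrM mulfV ?gt_eqF// powRr1.
rewrite invey /= powRr0 mulr1; case: ifPn => // _.
  by apply/ess_sup_inf.ess_supP/nearW => x; rewrite /= lee_fin normr_id; exact: rM.
Qed.

End restriction.

Section bounded_form.
Context {R : realType} {d : nat} {E H : normedModType R}.
Variable t : {bilinear Linfc d E -> Linfc d H -> R | *%R & *%R}.

Lemma biscalar_restr P Q : biscalar (fun f g => t (restr P f) (restr Q g)).
Proof.
by split=> [g|f] a x y; rewrite restr_linear ?linearPl ?linearPr.
Qed.

Variables (p q : \bar R).
Hypotheses (p_ge1 : (1 <= p)%E) (q_ge1 : (1 <= q)%E) (pq : (1 <= p^-1 + q^-1)%E).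
Hypothesis t_bounded : exists C : R, forall (f : Linfc d E) (g : Linfc d H),
  (`|t f g|%:E <= C%:E * LpNorm p f * LpNorm q g)%E.

Let fin_inve (r : \bar R) : (1 <= r)%E -> r^-1%E \is a fin_num /\ 0 <= fine r^-1%E.
Proof.
case: r => [r| |]//.
rewrite lee_fin => r1; have r0 : 0 < r by rewrite (lt_le_trans ltr01).
by rewrite inver gt_eqF//= invr_ge0 ltW.
Qed.

(* Since 1/p + 1/q >= 1, Holder's bound is at most linear in |Q| once |Q| is
   bounded. *)
Lemma local_form_le (f : Linfc d E) (g : Linfc d H) (s : R) : 0 < s ->
  exists2 C : R, 0 <= C & forall Q : cube R d, 0 < side Q -> side Q <= s ->
    `|t (restr (dilate 3 Q) f) (restr Q g)| <= C * side Q ^+ d.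
Proof.
move=> s0; have [C tC] := t_bounded.
have [M M0 fM] := Linfc_bounded f; have [N N0 gN] := Linfc_bounded g.
have [pfin p0] := fin_inve p_ge1; have [qfin q0] := fin_inve q_ge1.
set a := fine p^-1 in p0; set b := fine q^-1 in q0.
have ab : 1 <= a + b by rewrite -lee_fin /a /b EFinD !fineK.
(* The power of [3 ^+ d] comes from the dilate 3Q; the last factor bounds [|Q|] to the power
   [a + b - 1], which is nonnegative. The sign of [C] is unknown, hence its absolute value. *)
exists (`|C| * M * N * (3 ^+ d) `^ a * (s ^+ d) `^ (a + b - 1)).
  by rewrite !mulr_ge0// powR_ge0.
move=> Q Q0 Qs; set v := side Q ^+ d.
have v0 : 0 < v by rewrite exprn_gt0.
have Q30 : 0 <= side (dilate 3 Q) by exact: mulr_ge0 (ltW Q0).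
have := LpNorm_restr_le p_ge1 Q30 fM.
rewrite (_ : side (dilate 3 Q) = 3 * side Q)// => hf.
have hg := LpNorm_restr_le q_ge1 (ltW Q0) gN.
rewrite exprMn -/v -/a in hf; rewrite -/v -/b in hg.
rewrite -lee_fin; apply: le_trans (tC _ _) _.
have step : (C%:E * LpNorm p (restr (dilate 3 Q) f) * LpNorm q (restr Q g) <=
    `|C|%:E * (M * (3 ^+ d * v) `^ a)%:E * (N * v `^ b)%:E)%E.
  apply: (@le_trans _ _ (`|C|%:E * LpNorm p (restr (dilate 3 Q) f) *
      LpNorm q (restr Q g))%E).
    by do 2 (apply: lee_wpmul2r; first exact: Lnorm_ge0); rewrite lee_fin ler_norm.
  apply: lee_pmul hg; rewrite ?mule_ge0 ?Lnorm_ge0//.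
  exact: lee_wpmul2l.
apply: le_trans step _; rewrite -!EFinM lee_fin.
rewrite powRM ?(ltW v0) ?exprn_ge0//.
have -> : `|C| * (M * ((3 ^+ d) `^ a * v `^ a)) * (N * v `^ b) =
    `|C| * M * N * (3 ^+ d) `^ a * (v `^ a * v `^ b) by ring.
have -> : v `^ a * v `^ b = v * v `^ (a + b - 1).
  rewrite -powRD; last by rewrite (gt_eqF v0) implybT.
  by rewrite mulr_powRB1 ?(ltW v0)// (lt_le_trans _ ab).
rewrite [leLHS]mulrA [leRHS]mulrAC ler_wpM2l//.
  by rewrite !mulr_ge0 ?powR_ge0// ltW.
have [Q0' s0'] := (ltW Q0, ltW s0).
by apply: ge0_ler_powR; rewrite ?subr_ge0// ?nnegrE ?exprn_ge0// lerXn2r ?nnegrE.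
Qed.

End bounded_form.

(** * Sparse iteration *)

Inductive descendant T (M : T -> set T) : T -> T -> Prop :=
| descendant_refl x : descendant M x x
| descendant_step x y z : M x y -> descendant M y z -> descendant M x z.

Section sparse_iteration.
Context {R : realType} {d : nat} (D : int -> set (cube R d)).
Hypothesis D_dyadic : dyadic_system D.
(** In the application [M Q] consists of the exceptional cubes of [Q], [T Q] is the form cut off to
    [Q], [A Q] the main term there, and [theta] is n eps. *)
Variables (Q0 : cube R d) (M : cube R d -> set (cube R d)).
Variables (T : cube R d -> R) (A : cube R d -> \bar R) (theta C : R).

Let good Q := cubes_of D Q /\ cset Q `<=` cset Q0.

Hypothesis DQ0 : cubes_of D Q0.
Hypothesis M_sub : forall Q, good Q -> M Q `<=` cubes_of D.
Hypothesis M_in : forall Q K, good Q -> M Q K -> cset K `<=` cset Q.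
Hypothesis M_triv : forall Q, good Q -> trivIset (M Q) cset.
Hypothesis M_vol : forall Q, good Q ->
  (\esum_(K in M Q) vol K <= theta%:E * vol Q)%E.
Hypothesis T_step : forall Q, good Q ->
  (`|T Q|%:E <= A Q + \esum_(K in M Q) `|T K|%:E)%E.
Hypothesis T_vol : forall Q, good Q -> (`|T Q|%:E <= C%:E * vol Q)%E.
Hypothesis A_ge0 : forall Q, good Q -> (0 <= A Q)%E.
Hypotheses (C_ge0 : 0 <= C) (theta_ge0 : 0 <= theta) (theta_lt1 : theta < 1).

Let good0 : good Q0. Proof. by split. Qed.

Let M_good Q K : good Q -> M Q K -> good K.
Proof.
move=> gQ MK; split; first exact: M_sub gQ _ MK.
exact: subset_trans (M_in gQ MK) gQ.2.
Qed.

Let descendant_good Q S : descendant M Q S -> good Q ->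
  good S /\ cset S `<=` cset Q.
Proof.
elim=> [P gP|P K {}S MK _ IH gP]; first by split.
have [gS SK] := IH (M_good gP MK); split => //.
exact: subset_trans (M_in gP MK).
Qed.

(** Both paths are followed down from [Q]. Siblings are disjoint, so two descendants that meet must
    take the same child at each step until one path ends. *)
Let descendant_comparable Q S S' : descendant M Q S -> good Q ->
  descendant M Q S' -> cset S `&` cset S' !=set0 ->
  descendant M S S' \/ descendant M S' S.
Proof.
elim=> [P gP PS' _|P K {}S MK KS IH gP PS' meet]; first by left.
case: PS' IH meet gP MK => [P' _ meet gP' MK|P' K' {}S' MK' K'S' IH meet gP' MK].
  by right; exact: descendant_step MK KS.
have [gK gK'] := (M_good gP' MK, M_good gP' MK').
apply: IH => //; suff -> : K = K' by [].
apply: (M_triv gP' MK MK'); have [x [Sx S'x]] := meet; exists x; split.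
  exact: (descendant_good KS gK).2.
exact: (descendant_good K'S' gK').2.
Qed.

(** A child has volume at most [theta] times that of [Q], hence strictly less, and cannot contain
    [Q]. *)
Let descendant_irrefl Q K : good Q -> M Q K -> ~ descendant M K Q.
Proof.
move=> gQ MK KQ; have gK := M_good gQ MK.
have := le_vol (descendant_good KQ gK).2; apply/negP; rewrite -ltNge.
apply: (@le_lt_trans _ _ (theta%:E * vol Q)%E).
  apply: le_trans (M_vol gQ); rewrite -(esum_set1 (a := @vol R d)); last first.
    exact/ltW/(vol_gt0 D_dyadic)/gK.1.
  by apply: esum_subset => _ ->.
rewrite -[ltRHS]mul1e lte_pmul2r ?lte_fin//; first exact: vol_fin_num gQ.1.
exact: vol_gt0 gQ.1.
Qed.

(** The main terms of the first m generations, summed along the tree of children. *)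
Fixpoint truncated_sum m Q : \bar R :=
  if m is m'.+1 then (A Q + \esum_(K in M Q) truncated_sum m' K)%E else 0%E.

Let truncated_sum_ge0 m Q : good Q -> (0 <= truncated_sum m Q)%E.
Proof.
elim: m Q => //= m IH Q gQ; rewrite adde_ge0 ?A_ge0// esum_ge0// => K MK.
exact/IH/(M_good gQ).
Qed.

(** After m uses of [T_step] only the form on generation m remains; [T_vol] bounds it by volume, and
    [M_vol] contributes a factor [theta] per generation. *)
Let T_le_truncated m Q : good Q ->
  (`|T Q|%:E <= truncated_sum m Q + (C * theta ^+ m)%:E * vol Q)%E.
Proof.
elim: m Q => [|m IH] Q gQ; first by rewrite add0e expr0 mulr1 T_vol.
apply: le_trans (T_step gQ) _; rewrite /= -addeA leeD2l//.
apply: (@le_trans _ _ (\esum_(K in M Q)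
    (truncated_sum m K + (C * theta ^+ m)%:E * vol K))%E).
  by apply: le_esum => K MK; exact/IH/(M_good gQ).
have r0 : 0 <= C * theta ^+ m by rewrite mulr_ge0// exprn_ge0.
have vol0 K : M Q K -> (0 <= vol K)%E.
  by move=> MK; exact/ltW/(vol_gt0 D_dyadic)/(M_good gQ MK).1.
rewrite esumD => [|K MK|K MK]; last 2 first.
- exact/truncated_sum_ge0/(M_good gQ).
- by rewrite mule_ge0// vol0.
rewrite leeD2l//; apply: le_trans (esumZl_le r0 vol0) _.
rewrite exprSr mulrA [in leRHS]EFinM -muleA lee_wpmul2l//; exact: M_vol.
Qed.

(** Nested sums become one sum over a set because no cube is reached twice: [Q] does not recur below
    its children, and distinct children have no common descendant. *)
Let truncated_sum_le m Q : good Q ->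
  (truncated_sum m Q <= \esum_(S in descendant M Q) A S)%E.
Proof.
elim: m Q => [|m IH] Q gQ.
  by apply: esum_ge0 => S QS; exact/A_ge0/(descendant_good QS gQ).1.
have A0 S : descendant M Q S -> (0 <= A S)%E.
  by move=> QS; exact/A_ge0/(descendant_good QS gQ).1.
rewrite /= [leRHS](esumID [set Q])// leeD//.
  rewrite (_ : _ `&` _ = [set Q]) ?esum_set1// ?A_ge0//.
  by apply/seteqP; split => [S []//|_ ->]; split => //; exact: descendant_refl.
apply: (@le_trans _ _ (\esum_(K in M Q) \esum_(S in descendant M K) A S)%E).
  by apply: le_esum => K MK; exact/IH/(M_good gQ).
apply: esum_esum_le.
- by move=> S [/A0].
- move=> K MK S KS; split; first exact: descendant_step MK KS.
  by move=> /= SQ; rewrite SQ in KS; exact: descendant_irrefl MK KS.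
- move=> K L MK ML [S [KS LS]].
  have [gS SK] := descendant_good KS (M_good gQ MK).
  (* A common descendant would lie in both children, and its center would be a point of two disjoint
     cubes. *)
  have [_ SL] := descendant_good LS (M_good gQ ML).
  apply: (M_triv gQ MK ML); exists (Defs.center S).
  have Sc := cset_center (side_gt0 D_dyadic gS.1).
  by split; [exact: SK|exact: SL].
Qed.

Lemma sum_over_descendants : (`|T Q0|%:E <= \esum_(S in descendant M Q0) A S)%E.
Proof.
apply/lee_addgt0Pr => e e0.
have [v vE] : exists v, vol Q0 = v%:E.
  by exists (fine (vol Q0)); rewrite fineK//; exact: vol_fin_num DQ0.
have [m me] : exists m, C * theta ^+ m * v < e.
  have : (C * theta ^+ m * v @[m --> \oo] --> C * 0 * v).
    apply: cvgMl; apply: cvgMr; apply: cvg_expr.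
    by rewrite ger0_norm.
  rewrite mulr0 mul0r => /cvgr_lt/(_ _ e0)[m _ small]; exists m.
  exact: (small m (leqnn m)).
apply: le_trans (T_le_truncated m good0) _.
by rewrite leeD ?truncated_sum_le// vE -EFinM lee_fin ltW.
Qed.

Lemma sparse_descendants : sparse (1 - theta) (descendant M Q0).
Proof.
exists (fun S => cset S `\` \bigcup_(K in M S) cset K); split.
  move=> S S' QS QS' [x [[Sx nSx] [S'x nS'x]]].
  have [gS _] := descendant_good QS good0.
  have [gS' _] := descendant_good QS' good0.
  (* A nontrivial path from [P] to [P'] enters a child of [P], and this child would contain [y]. *)
  have sub P P' y : good P -> descendant M P P' -> cset P' y ->
      ~ (\bigcup_(K in M P) cset K) y -> P = P'.
    move=> gP PP' P'y nPy; case: PP' gP P'y nPy => // P1 K P2 MK KP2 gP1 P2y.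
    by case; exists K => //; apply: (descendant_good KP2 (M_good gP1 MK)).2.
  have [SS'|S'S] := descendant_comparable QS good0 QS' (ex_intro _ x (conj Sx S'x)).
    exact: sub SS' S'x nSx.
  exact/esym/(sub _ _ _ gS' S'S Sx nS'x).
move=> S QS; have [gS _] := descendant_good QS good0.
have mM : measurable (\bigcup_(K in M S) cset K).
  by apply: (measurable_bigcup_cubes D_dyadic); exact: M_sub.
have mS := measurable_cset S.
split; [exact: measurableD|by move=> x []|].
have volfin := vol_fin_num D_dyadic gS.1.
have MS : (lebesgue_rV d (\bigcup_(K in M S) cset K) <= theta%:E * vol S)%E.
  by rewrite (measure_bigcup_cubes D_dyadic (M_sub gS) (M_triv gS)) M_vol.
rewrite measureD//; last by rewrite -ge0_fin_numE.
rewrite EFinB muleBl// mul1e leeB// (le_trans _ MS)// le_measure ?inE//.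
  exact: measurableI.
Qed.

End sparse_iteration.

(** * The local estimate for vectors *)

Section dyadic_geometry.
Context {R : realType} {d : nat} (d_gt0 : (0 < d)%N) (D : int -> set (cube R d)).
Hypothesis D_dyadic : dyadic_system D.

(** Cubes of [B] lie in [Q], so their levels are bounded below by the level k of [Q]. Among those
    containing a given cube, one of least level exists and is maximal. *)
Lemma maximal_cubes Q (B : set (cube R d)) : cubes_of D Q -> B `<=` cubes_of D ->
  (forall K, B K -> cset K `<=` cset Q) ->
  exists M : set (cube R d), [/\ M `<=` B, trivIset M cset,
    forall K, B K -> exists2 P, M P & cset K `<=` cset P &
    forall P K, M P -> B K -> ~ (cset P `<` cset K)].
Proof.
move=> [k _ DQ] BD BQ.
pose M := [set P | B P /\ forall K, B K -> cset P `<=` cset K -> K = P].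
exists M; split.
- by move=> P [].
- move=> P K [BP maxP] [BK maxK] meet.
  have [PK|KP] := cubes_nested D_dyadic (BD _ BP) (BD _ BK) meet.
    exact/esym/maxP.
  exact: maxK.
(* Levels are written as k plus a natural number, so that a least one can be taken. *)
- move=> K BK; pose above m :=
    `[< exists2 P, B P /\ D (k + m%:Z) P & cset K `<=` cset P >].
  have level P : B P -> exists m : nat, D (k + m%:Z) P.
    move=> BP; have [j _ DP] := BD _ BP; exists `|j - k|%N.
    have kj := dyadic_level_le D_dyadic d_gt0 DP DQ (BQ _ BP).
    by rewrite gez0_abs ?subr_ge0// addrCA subrr addr0.
  have ex_above : exists m, above m.
    by have [m DK] := level _ BK; exists m; apply/asboolP; exists K.
  have [m /asboolP[P [BP DP] KP] min_m] := ex_minnP ex_above.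
  exists P => //; split => // L BL PL.
  have [l DL] := level _ BL.
  have ml : (m <= l)%N.
    by apply: min_m; apply/asboolP; exists L => //; exact: subset_trans PL.
  have := dyadic_level_le D_dyadic d_gt0 DP DL PL; rewrite lerD2l lez_nat => lm.
  have lE : l = m by apply/eqP; rewrite eqn_leq lm.
  rewrite lE in DL; apply: (dyadic_trivIset D_dyadic DL DP).
  have Pc := cset_center (side_gt0 D_dyadic (BD _ BP)).
  by exists (Defs.center P); split => //; exact: PL.
- by move=> P K [BP maxP] BK [PK nKP]; apply: nKP; rewrite (maxP K BK PK).
Qed.

(* Cubes are boxes, so one containing two opposite corners of a box contains
   that box. *)
Lemma bounded_sub_cube (N : R) : without_quadrants D ->
  exists2 Q, cubes_of D Q &
    forall x : 'rV[R]_d, (forall i, `|x ord0 i| <= N) -> cset Q x.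
Proof.
move=> noquad.
have [P DP PN] := dyadic_cover D_dyadic 0 (const_mx (- N)).
have [P' DP' PN'] := dyadic_cover D_dyadic 0 (const_mx N).
have [S DS sub] := noquad P P' (ex_intro2 _ _ 0 I DP) (ex_intro2 _ _ 0 I DP').
exists S => // x xN i.
have := sub _ (or_introl PN) i; have := sub _ (or_intror PN') i.
rewrite !mxE => /andP[_ h2] /andP[h1 _].
have := xN i; rewrite ler_norml => /andP[x1 x2].
by rewrite (le_trans h1 x1) (le_lt_trans x2 h2).
Qed.

Lemma Linfc_support {E : normedModType R} (f : Linfc d E) :
  exists N : R, forall x, f x != 0 -> forall i, `|x ord0 i| <= N.
Proof.
have := Linfc_funP f; rewrite inE => -[_ _ /compact_bounded].
move=> [N [_ /(_ (N + 1))]]; rewrite ltrDl ltr01 => /(_ isT) bN.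
exists (N + 1) => x fx i.
have : `|x| <= N + 1 by apply: bN; exact: subset_closure.
apply: le_trans; rewrite [leRHS]mx_normrE.
exact: (le_bigmax _ (fun ij => `|x ij.1 ij.2|) (ord0, i)).
Qed.

(** Provides the starting cube of the iteration, on which cutting off changes none of the
    functions. *)
Lemma support_cube {E H : normedModType R} n (f : 'I_n -> Linfc d E)
    (g : 'I_n -> Linfc d H) : without_quadrants D ->
  exists2 Q, cubes_of D Q & forall i,
    restr (dilate 3 Q) (f i) = f i /\ restr Q (g i) = g i.
Proof.
move=> noquad.
have /choice[N fN] := fun i => Linfc_support (f i).
have /choice[N' gN] := fun i => Linfc_support (g i).
pose B := \sum_i (`|N i| + `|N' i|).
have [Q DQ QB] := bounded_sub_cube B noquad.
have NB i : `|N i| + `|N' i| <= B.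
  by rewrite /B (bigD1 i)//= lerDl sumr_ge0// => j _; rewrite addr_ge0.
have Q0 := side_gt0 D_dyadic DQ.
exists Q => // i; split; apply: restr_id => x.
  move=> /(fN i) xN; have Qx : cset Q x.
    apply: QB => j; apply: le_trans (xN j) (le_trans _ (NB i)).
    by rewrite (le_trans (ler_norm _))// lerDl.
  move=> j; have /andP[h1 h2] := Qx j.
  rewrite /dilate /side /Defs.center /= -/(side Q) -/(Defs.center Q).
  apply/andP; split; lra.
move=> /(gN i) xN; apply: QB => j; apply: le_trans (xN j) (le_trans _ (NB i)).
by rewrite (le_trans (ler_norm _))// lerDr.
Qed.

End dyadic_geometry.

Section body_products.
Context {R : realType} {d : nat} {E H : normedModType R}.
Context {N : Linfc d E -> R} {P : Linfc d H -> R} {n : nat}.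
Variables (f : 'I_n -> Linfc d E) (g : 'I_n -> Linfc d H).

(** The supremum dominates its set only once that set is known to be bounded above; the sum of
    [N (f i) * P (g i)] is such a bound. *)
Lemma dot_set_pairing_bound :
  pairing_bound (N := N) (P := P) f g (dot_set (cvx_body N f) (cvx_body P g)).
Proof.
move=> phi psi phiN psiP; apply: ub_le_sup.
  exists (\sum_i N (f i) * P (g i)) => _ [_ [[phi' phi'N <-] [psi' psi'P <-]] <-].
  apply: ler_sum => i _; rewrite !mxE (le_trans (ler_norm _))// normrM.
  by apply: ler_pM.
exists (\row_i phi (f i), \row_i psi (g i)).
  by split; [exists phi|exists psi].
by apply: eq_bigr => i _; rewrite !mxE.
Qed.

Lemma is_norm_seminorm : is_norm N -> seminorm N.
Proof. by case. Qed.

End body_products.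

(** * The estimate on one cube *)

Section vector_local.
Context {R : realType} {d : nat} (d_gt0 : (0 < d)%N) (D : int -> set (cube R d)).
Hypothesis D_dyadic : dyadic_system D.
Context {E H : normedModType R}.
Variable t : {bilinear Linfc d E -> Linfc d H -> R | *%R & *%R}.

Definition local_form Q f g := t (restr (dilate 3 Q) f) (restr Q g).

Variables (c eps : R) (Q : cube R d).
Variables (N : Linfc d E -> R) (P : Linfc d H -> R).
Hypotheses (c_ge0 : 0 <= c) (DQ : cubes_of D Q).
Hypotheses (N_norm : is_norm N) (P_norm : is_norm P).
Hypothesis t_vol : forall f g, exists2 C : R, 0 <= C &
  forall K, cubes_of D K -> cset K `<=` cset Q ->
    (`|local_form K f g|%:E <= C%:E * vol K)%E.
Hypothesis t_local : forall f g, exists Qhat : set (cube R d),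
  [/\ Qhat `<=` cubes_of D, forall K, Qhat K -> cset K `<=` cset Q,
      trivIset Qhat cset, (\esum_(K in Qhat) vol K <= eps%:E * vol Q)%E &
  forall J : set (cube R d), J `<=` cubes_of D ->
    (forall K, J K -> cset K `<=` cset Q) -> trivIset J cset ->
    (forall K L, J K -> Qhat L -> ~ (cset K `<` cset L)) ->
    \bigcup_(L in Qhat) cset L `<=` \bigcup_(K in J) cset K ->
    (`|local_form Q f g - rsum J (fun K => local_form K f g)|%:E
       <= (c * N f * P g)%:E * vol Q)%E].

Lemma vector_local n (f : 'I_n -> Linfc d E) (g : 'I_n -> Linfc d H) :
  let T K := \sum_i local_form K (f i) (g i) in
  let l := dot_set (cvx_body N f) (cvx_body P g) in
  exists M : set (cube R d),
  [/\ M `<=` cubes_of D, forall K, M K -> cset K `<=` cset Q, trivIset M cset,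
      (\esum_(K in M) vol K <= (n%:R * eps)%:E * vol Q)%E &
      (`|T Q|%:E <= (c * n%:R `^ (3 / 2) * l)%:E * vol Q +
                    \esum_(K in M) `|T K|%:E)%E].
Proof.
move=> T l.
have [F [G [FG NPl]]] := auerbach_pair (is_norm_seminorm N_norm)
  (is_norm_seminorm P_norm) (dot_set_pairing_bound (N := N) (P := P) f g).
(* The pairs (F, G) are chosen for [Q] alone, yet they represent [T K] for every cube [K], since the
   decomposition holds for all bilinear forms at once. *)
have TE K : T K = \sum_i local_form K (F i) (G i) by exact/FG/biscalar_restr.
have /choice[Qh QhP] := fun i => t_local (F i) (G i).
pose B := \bigcup_i Qh i.
have BD : B `<=` cubes_of D.
  by move=> K [i _ QK]; have [+ _ _ _ _] := QhP i; exact.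
have BQ K : B K -> cset K `<=` cset Q.
  by move=> [i _ QK]; have [_ + _ _ _] := QhP i; apply.
(* These maximal cubes are an admissible covering family for all n pairs simultaneously: disjoint,
   covering each [Qh i], and strictly inside none of its cubes. *)
have [M [MB Mtriv Mabove Mmax]] := maximal_cubes d_gt0 D_dyadic DQ BD BQ.
have MD : M `<=` cubes_of D by exact: subset_trans BD.
have MQ K : M K -> cset K `<=` cset Q by move=> /MB/BQ.
have vol0 (K : cube R d) : (0 <= vol K)%E by exact: measure_ge0.
have [v v0 vE] : exists2 v, 0 <= v & vol Q = v%:E.
  exists (side Q ^+ d); last by rewrite (dyadic_vol D_dyadic).
  by rewrite exprn_ge0// ltW// (side_gt0 D_dyadic).
have Mvol : (\esum_(K in M) vol K <= (n%:R * eps)%:E * vol Q)%E.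
  apply: le_trans (esum_subset _ MB) _.
  apply: le_trans (esum_bigcup_le Qh vol0) _.
  apply: (@le_trans _ _ (\sum_(i < n) (eps%:E * vol Q))%E).
    by apply: lee_sum => i _; have [_ _ _ + _] := QhP i.
  by rewrite vE -!EFinM sumEFin sumr_const card_ord -(mulr_natl (eps * v)) mulrA.
exists M; split => //.
(* Summability makes [rsum] additive; it follows from the volume bound on the form and the finite
   total volume of [M]. *)
have Msum i : summable M (EFin \o (fun K => local_form K (F i) (G i))).
  have [C C0 CK] := t_vol (F i) (G i).
  apply: (@le_lt_trans _ _ (\esum_(K in M) (C%:E * vol K))%E).
    by apply: le_esum => K MK; exact: CK (MD _ MK) (MQ _ MK).
  apply: le_lt_trans (esumZl_le C0 _) _ => //.
  have : (C%:E * (\esum_(K in M) vol K) <= C%:E * ((n%:R * eps)%:E * vol Q))%E.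
    by rewrite lee_wpmul2l.
  by move=> /le_lt_trans; apply; rewrite vE -!EFinM ltry.
have rsumT : rsum M T = \sum_i rsum M (fun K => local_form K (F i) (G i)).
  by rewrite -rsum_sum//; congr rsum; apply/funext => K; rewrite TE.
have sumT : summable M (EFin \o T).
  have -> : T = (fun K => \sum_i local_form K (F i) (G i)) by exact/funext.
  exact: summable_sum.
have main : `|T Q - rsum M T| <= c * n%:R `^ (3 / 2) * l * v.
  rewrite rsumT TE -sumrB; apply: le_trans (ler_norm_sum _ _ _) _.
  (* One factor n counts the pairs and [sqrt n] is the loss per pair. *)
  have -> : n%:R `^ (3 / 2) = n%:R * Num.sqrt n%:R :> R.
    have -> : 3 / 2 = 1 + 2^-1 :> R by lra.
    rewrite -mulr_powRB1//.
    by rewrite addrAC subrr add0r powR12_sqrt.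
  apply: (@le_trans _ _ (\sum_(i < n) c * (Num.sqrt n%:R * l) * v)); last first.
    rewrite sumr_const card_ord -(mulr_natl (_ * v)).
    by rewrite le_eqVlt; apply/orP; left; apply/eqP; ring.
  apply: ler_sum => i _; have [_ _ _ _ /(_ M MD MQ Mtriv)] := QhP i.
  rewrite vE -EFinM lee_fin => h; apply: le_trans (h _ _) _.
  - by move=> K L MK QL; apply: Mmax => //; exists i.
  - move=> x [L QL Lx]; have [|K MK LK] := Mabove L; first by exists i.
    by exists K => //; exact: LK.
  by rewrite -(mulrA c) ler_wpM2r// ler_wpM2l.
apply: (@le_trans _ _ (`|T Q - rsum M T|%:E + `|rsum M T|%:E)%E).
  by rewrite -EFinD lee_fin -{1}(subrK (rsum M T) (T Q)) ler_normD.
by rewrite leeD ?abs_rsum_le// vE -EFinM lee_fin.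
Qed.

End vector_local.

(** * From the one-cube estimate to the sparse sum *)

Theorem corollary5p4 (R : realType) (d : nat) (d_gt0 : (0 < d)%N)
  (D : int -> set (cube R d))
  (D_dyadic : dyadic_system D) (D_noquad : without_quadrants D)
  (E H : completeNormedModType R)
  (t : {bilinear Linfc d E -> Linfc d H -> R | *%R & *%R})
  (p q : \bar R) (p_ge1 : (1 <= p)%E) (q_ge1 : (1 <= q)%E)
  (pq : (1 <= p^-1 + q^-1)%E)
  (t_bounded : exists C : R, forall (f : Linfc d E) (g : Linfc d H),
     (`|t f g|%:E <= C%:E * LpNorm p f * LpNorm q g)%E)
  (eps c : R) (eps_gt0 : 0 < eps) (c_ge0 : 0 <= c)
  (X : cube R d -> Linfc d E -> R) (Y : cube R d -> Linfc d H -> R)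
  (X_norm : forall Q, cubes_of D Q -> is_norm (X Q))
  (Y_norm : forall Q, cubes_of D Q -> is_norm (Y Q))
  (t_local : forall (f : Linfc d E) (g : Linfc d H) (Q : cube R d),
     cubes_of D Q ->
     exists Qhat : set (cube R d),
       [/\ Qhat `<=` cubes_of D,
           forall K, Qhat K -> cset K `<=` cset Q,
           trivIset Qhat cset,
           (\esum_(K in Qhat) vol K <= eps%:E * vol Q)%E &
           forall J : set (cube R d),
             J `<=` cubes_of D ->
             (forall P, J P -> cset P `<=` cset Q) ->
             trivIset J cset ->
             (forall P K, J P -> Qhat K -> ~ (cset P `<` cset K)) ->
             \bigcup_(K in Qhat) cset K `<=` \bigcup_(P in J) cset P ->
             (`|t (restr (dilate 3 Q) f) (restr Q g) -
                rsum J (fun P => t (restr (dilate 3 P) f) (restr P g))|%:E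
              <= (c * X Q f * Y Q g)%:E * vol Q)%E])
  (n : nat) (n_gt0 : (0 < n)%N) (neps_lt1 : n%:R * eps < 1)
  (f : 'I_n -> Linfc d E) (g : 'I_n -> Linfc d H) :
  exists SS : set (cube R d),
    [/\ SS `<=` cubes_of D,
        sparse (1 - n%:R * eps) SS &
        (`|\sum_(i < n) t (f i) (g i)|%:E
         <= (c * n%:R `^ (3 / 2))%:E *
            \esum_(S in SS)
               ((dot_set (cvx_body (X S) f) (cvx_body (Y S) g))%:E * vol S))%E].
Proof.
have [Q0 DQ0 Q0E] := support_cube D_dyadic f g D_noquad.
pose T Q := \sum_(i < n) local_form t Q (f i) (g i).
pose l Q := dot_set (cvx_body (X Q) f) (cvx_body (Y Q) g).
pose theta := n%:R * eps; pose cn := c * n%:R `^ (3 / 2).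
pose good Q := cubes_of D Q /\ cset Q `<=` cset Q0.
have t_vol u v : exists2 C : R, 0 <= C & forall Q, good Q ->
    (`|local_form t Q u v|%:E <= C%:E * vol Q)%E.
  have Q0_gt0 := side_gt0 D_dyadic DQ0.
  have [C C0 CQ] := local_form_le p_ge1 q_ge1 pq t_bounded u v Q0_gt0.
  exists C => // Q [DQ QQ0]; rewrite (dyadic_vol D_dyadic DQ) -EFinM lee_fin.
  apply: CQ; first exact: (side_gt0 D_dyadic DQ).
  (* The inequality between side lengths is read off from the volumes. *)
  have := le_vol QQ0; rewrite !(dyadic_vol D_dyadic)// lee_fin.
  by rewrite ler_pXn2r// nnegrE ltW// (side_gt0 D_dyadic).
have /choice[M MP] Q : exists M : set (cube R d), good Q ->
    [/\ M `<=` cubes_of D, forall K, M K -> cset K `<=` cset Q, trivIset M cset,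
        (\esum_(K in M) vol K <= theta%:E * vol Q)%E &
        (`|T Q|%:E <= (cn * l Q)%:E * vol Q + \esum_(K in M) `|T K|%:E)%E].
  (* Cubes outside the tree below [Q0] get the default empty family; nothing is claimed about
     them. *)
  have [gQ|] := pselect (good Q); last by exists set0.
  have t_volQ u v : exists2 C : R, 0 <= C & forall K, cubes_of D K ->
      cset K `<=` cset Q -> (`|local_form t K u v|%:E <= C%:E * vol K)%E.
    have [C C0 CK] := t_vol u v; exists C => // K DK KQ; apply: CK; split => //.
    exact: subset_trans gQ.2.
  have [M MP] := vector_local d_gt0 D_dyadic c_ge0 gQ.1 (X_norm Q gQ.1)
    (Y_norm Q gQ.1) t_volQ (fun u v => t_local u v Q gQ.1) f g.
  by exists M.
have n_ge0 : 0 <= n%:R `^ (3 / 2) :> R by exact: powR_ge0.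
have cn0 : 0 <= cn by rewrite mulr_ge0.
have l0 Q : cubes_of D Q -> 0 <= l Q.
  move=> DQ; exact: (pairing_bound_ge0 (is_norm_seminorm (X_norm Q DQ))
    (is_norm_seminorm (Y_norm Q DQ)) (dot_set_pairing_bound f g)).
have vol0 Q : cubes_of D Q -> (0 <= vol Q)%E.
  by move=> DQ; exact/ltW/(vol_gt0 D_dyadic).
have [C C0 CT] : exists2 C : R, 0 <= C &
    forall Q, good Q -> (`|T Q|%:E <= C%:E * vol Q)%E.
  have /choice[C CP] i : exists C : R, 0 <= C /\ forall Q, good Q ->
      (`|local_form t Q (f i) (g i)|%:E <= C%:E * vol Q)%E.
    by have [C C0 CQ] := t_vol (f i) (g i); exists C.
  exists (\sum_i C i); first by rewrite sumr_ge0// => i _; exact: (CP i).1.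
  move=> Q gQ; apply: (@le_trans _ _ (\sum_i (C i)%:E * vol Q)%E).
    apply: (@le_trans _ _ (\sum_i `|local_form t Q (f i) (g i)|%:E)%E).
      by rewrite sumEFin lee_fin ler_norm_sum.
    by apply: lee_sum => i _; exact: (CP i).2.
  rewrite -ge0_sume_distrl ?sumEFin// => i _.
  by rewrite lee_fin; exact: (CP i).1.
have A0 Q : good Q -> (0 <= (cn * l Q)%:E * vol Q)%E.
  by move=> [DQ _]; rewrite mule_ge0 ?vol0// lee_fin mulr_ge0 ?l0.
have th0 : 0 <= theta by rewrite mulr_ge0// ltW.
have M1 Q (gQ : good Q) := let: And5 a _ _ _ _ := MP Q gQ in a.
have M2 Q K (gQ : good Q) := (let: And5 _ a _ _ _ := MP Q gQ in a) K.
have M3 Q (gQ : good Q) := let: And5 _ _ a _ _ := MP Q gQ in a.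
have M4 Q (gQ : good Q) := let: And5 _ _ _ a _ := MP Q gQ in a.
have M5 Q (gQ : good Q) := let: And5 _ _ _ _ a := MP Q gQ in a.
have desc_D : descendant M Q0 `<=` cubes_of D.
  suff h Q S : descendant M Q S -> good Q -> cubes_of D S.
    by move=> S /h; apply; split.
  elim=> [P []//|P K {}S PK _ IH gP]; apply: IH; split; first exact: M1 PK.
  exact: subset_trans (M2 _ _ gP PK) gP.2.
exists (descendant M Q0); split => //.
  exact: (sparse_descendants D_dyadic DQ0 M1 M2 M3 M4).
have := sum_over_descendants D_dyadic DQ0 M1 M2 M3 M4 M5 CT A0 C0 th0 neps_lt1.
(* By the choice of [Q0] the cutoffs leave all [f i] and [g i] unchanged. *)
have -> : T Q0 = \sum_(i < n) t (f i) (g i).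
  by apply: eq_bigr => i _; rewrite /local_form (Q0E i).1 (Q0E i).2.
move=> /le_trans; apply.
apply: le_trans (esumZl_le cn0 _) => [|S DS].
  by apply: le_esum => S DS; rewrite EFinM muleA.
by rewrite mule_ge0 ?vol0 ?lee_fin ?l0//; exact: desc_D.
Qed.
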